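(* Let $n\ge3$, $\frac{\sqrt{n-1}}2<t\le\frac{\sqrt n}2$, and $a^{[n]}:=\frac1{\sqrt n}(1,\dots,1)\in S^{n-1}$. Then for all $a\in S^{n-1}$, $$A(a,t)\le A(a^{[n]},t)=\frac{n^{n/2}}{(n-1)!}\Big(\frac{\sqrt n}2-t\Big)^{n-1}.$$ For $n=2$ the same inequality holds for $\frac38\sqrt2<t\le\frac1{\sqrt2}$, and it fails for some $a$ when $\frac12<t<\frac38\sqrt2$.
   Context: $Q^n=[-\frac12,\frac12]^n\subset\mathbb{R}^n$ is the unit-volume cube. For $a\in S^{n-1}$, $t\in\mathbb{R}$, $H_t(a)=\{x\in\mathbb{R}^n:\langle a,x\rangle=t\}$ and $A(a,t)=\mathrm{vol}_{n-1}(H_t(a)\cap Q^n)$. *)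

(* Defs.v *)
From Stdlib Require Import Reals Arith Lra Lia List ClassicalEpsilon.
Import ListNotations.
Open Scope R_scope.

(* Vectors of R^n are functions nat -> R; only coordinates 0..n-1 matter. *)
Fixpoint sumR (n : nat) (f : nat -> R) : R :=
  match n with O => 0 | S k => sumR k f + f k end.

Fixpoint prodR (n : nat) (f : nat -> R) : R :=
  match n with O => 1 | S k => prodR k f * f k end.

Definition dot (n : nat) (x y : nat -> R) : R := sumR n (fun i => x i * y i).

Definition on_sphere (n : nat) (a : nat -> R) : Prop := dot n a a = 1.

Definition in_cube (n : nat) (x : nat -> R) : Prop :=
  forall i, (i < n)%nat -> -(1/2) <= x i <= 1/2.

Definition Rsup (E : R -> Prop) : R :=
  epsilon (inhabits 0) (fun v => is_lub E v).

Definition box := ((nat -> R) * (nat -> R))%type.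
Definition box_ok (m : nat) (b : box) : Prop :=
  forall i, (i < m)%nat -> fst b i <= snd b i.
Definition in_cbox (m : nat) (b : box) (x : nat -> R) : Prop :=
  forall i, (i < m)%nat -> fst b i <= x i <= snd b i.
Definition in_obox (m : nat) (b : box) (x : nat -> R) : Prop :=
  forall i, (i < m)%nat -> fst b i < x i < snd b i.
Definition box_vol (m : nat) (b : box) : R :=
  prodR m (fun i => snd b i - fst b i).
Definition dummy_box : box := (fun _ => 0, fun _ => 0).

(* Inner Jordan content of S ⊆ R^m: supremum of the total volume of finite
   families of closed boxes contained in S with pairwise disjoint interiors.
   For compact convex sets this coincides with Lebesgue measure. *)
Definition inner_content (m : nat) (S : (nat -> R) -> Prop) : R :=
  Rsup (fun r => exists bs : list box,
    (forall k, (k < length bs)%nat -> box_ok m (nth k bs dummy_box)) /\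
    (forall k, (k < length bs)%nat ->
        forall x, in_cbox m (nth k bs dummy_box) x -> S x) /\
    (forall k l, (k < length bs)%nat -> (l < length bs)%nat -> k <> l ->
        forall x, ~ (in_obox m (nth k bs dummy_box) x /\
                     in_obox m (nth l bs dummy_box) x)) /\
    r = sumR (length bs) (fun k => box_vol m (nth k bs dummy_box))).

Definition orth_basis_compl (n : nat) (a : nat -> R) (u : nat -> nat -> R) : Prop :=
  (forall i j, (i < n - 1)%nat -> (j < n - 1)%nat ->
      dot n (u i) (u j) = if Nat.eqb i j then 1 else 0) /\
  (forall i, (i < n - 1)%nat -> dot n (u i) a = 0).

(* A chosen orthonormal basis of a^⊥ (exists whenever a is a unit vector). *)
Definition basis_compl (n : nat) (a : nat -> R) : nat -> nat -> R :=
  epsilon (inhabits (fun _ _ => 0)) (orth_basis_compl n a).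

(* Isometric parametrisation y ∈ R^{n-1} ↦ t a + Σ y_i u_i of H_t(a). *)
Definition hyper_param (n : nat) (a : nat -> R) (t : R) (u : nat -> nat -> R)
  (y : nat -> R) : nat -> R :=
  fun k => t * a k + sumR (n - 1) (fun i => y i * u i k).

(* A(a,t) = vol_{n-1}(H_t(a) ∩ Q^n), computed in the isometric chart. *)
Definition A (n : nat) (a : nat -> R) (t : R) : R :=
  inner_content (n - 1)
    (fun y => in_cube n (hyper_param n a t (basis_compl n a) y)).

Definition adiag (n : nat) : nat -> R := fun _ => 1 / sqrt (INR n).

(* Main.v *)
(* A hyperplane at distance [t > sqrt (n-1) / 2] from the centre passes beyond the midpoint of
   every edge, so it cuts off at most one vertex of the cube, and the section is empty, a point, or
   the simplex [z_i >= 0, sum |a_i| z_i = delta] with [delta = (sum |a_i|) / 2 - t].  Its volume is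
   [delta^(n-1) / ((n-1)! prod |a_i|)].  To see this for the inner content in an arbitrary
   orthonormal chart, scalings, shears and permutations multiply inner content by at least the
   absolute value of their determinant; by the LUP decomposition this holds for every invertible
   matrix, and applying it to the inverse as well gives equality.  The determinant of the chart is
   a minor of an orthogonal matrix.

   For [n >= 3] it remains to bound [prod |a_i|] from below.  Replacing [t] by [sqrt (n-1) / 2] only
   weakens the bound.  With [b_i = sqrt n |a_i|] the claim becomes
   [(1 - E / E0)^(n-1) <= prod b_i] where [sum b_i = n - E], [sum b_i^2 = n] and
   [E0 = n - sqrt (n (n-1))].  For [n = 2] everything is a function of [|a_0| + |a_1|]. *)
Require Import Defs.
From Stdlib Require Import Reals Arith Lra Lia List ClassicalEpsilon.
From Coquelicot Require Import Coquelicot.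
Import ListNotations.
Open Scope R_scope.

(** A finite family of boxes certifies only a lower bound on inner content, so [expands] is
    one-sided. The main upper estimate made directly is that for the standard simplex, by
    integrating over slices; for a simplicial section, an excess would pull back to an excess there.
    Replacing [t] is allowed because [((sum |a_i|) / 2 - t) / (sqrt n / 2 - t)] does not increase
    with [t] when [sum |a_i| <= sqrt n]. The product bound replaces logarithms by quadratics,
    [ln b >= b - 1 - 13/10 * (b - 1)^2]. Summed up, this gives [exp (- 18/5 * E)], and comparison
    with [(1 - E / E0)^2] uses [E0 <= 5/9]. This holds for [n >= 3], where [E0 <= 3 - sqrt 6],
    whereas [E0 = 2 - sqrt 2 > 5/9] for [n = 2]. The quadratic bound fails near [b = 0]; but
    [sum (b_i - 1)^2 = 2 * E < 9/8], so at most one coordinate is below [1/4]. *)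

(** * Finite sums and products *)

Lemma sumR_ext n f g : (forall i, (i < n)%nat -> f i = g i) -> sumR n f = sumR n g.
Proof.
  induction n as [|n IH]; intros H; simpl; [easy|].
  rewrite IH, (H n); [easy|lia|intros; apply H; lia].
Qed.

Lemma prodR_ext n f g : (forall i, (i < n)%nat -> f i = g i) -> prodR n f = prodR n g.
Proof.
  induction n as [|n IH]; intros H; simpl; [easy|].
  rewrite IH, (H n); [easy|lia|intros; apply H; lia].
Qed.

Lemma sumR_plus n f g : sumR n (fun i => f i + g i) = sumR n f + sumR n g.
Proof. induction n as [|n IH]; simpl; [lra|rewrite IH; lra]. Qed.

Lemma sumR_scal n c f : sumR n (fun i => c * f i) = c * sumR n f.
Proof. induction n as [|n IH]; simpl; [lra|rewrite IH; lra]. Qed.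

Lemma sumR_const n c : sumR n (fun _ => c) = INR n * c.
Proof. induction n as [|n IH]; [simpl; lra|]. rewrite S_INR. simpl. rewrite IH. lra. Qed.

Lemma sumR_le n f g : (forall i, (i < n)%nat -> f i <= g i) -> sumR n f <= sumR n g.
Proof.
  induction n as [|n IH]; intros H; simpl; [lra|].
  apply Rplus_le_compat; [apply IH; intros; apply H; lia|apply H; lia].
Qed.

Lemma sumR_nonneg n f : (forall i, (i < n)%nat -> 0 <= f i) -> 0 <= sumR n f.
Proof.
  intros H. rewrite <- (Rmult_0_r (INR n)), <- sumR_const. now apply sumR_le.
Qed.

Lemma sumR_swap n m f :
  sumR n (fun i => sumR m (fun j => f i j)) = sumR m (fun j => sumR n (fun i => f i j)).
Proof.
  induction n as [|n IH]; simpl.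
  - now rewrite sumR_const, Rmult_0_r.
  - now rewrite IH, <- sumR_plus.
Qed.

Lemma sumR_shift n f : sumR (S n) f = f 0%nat + sumR n (fun i => f (S i)).
Proof.
  induction n as [|n IH]; [simpl; lra|].
  change (sumR (S (S n)) f) with (sumR (S n) f + f (S n)).
  rewrite IH. simpl. lra.
Qed.

Lemma sumR_update n f g k :
  (k < n)%nat -> (forall i, (i < n)%nat -> i <> k -> f i = g i) ->
  sumR n f = sumR n g + f k - g k.
Proof.
  induction n as [|n IH]; intros Hk H; [lia|simpl].
  destruct (Nat.eq_dec k n) as [->|Hn].
  - rewrite (sumR_ext n f g); [lra|intros; apply H; lia].
  - rewrite IH, (H n); [lra|lia|lia|lia|intros; apply H; lia].
Qed.

Lemma sumR_single n f k :
  (k < n)%nat -> (forall i, (i < n)%nat -> i <> k -> f i = 0) -> sumR n f = f k.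
Proof.
  intros Hk H. rewrite (sumR_update n f (fun _ => 0) k Hk H), sumR_const. lra.
Qed.

(** Cross-multiplied instead of divided, so that [g k] may be zero. *)
Lemma prodR_update n f g k :
  (k < n)%nat -> (forall i, (i < n)%nat -> i <> k -> f i = g i) ->
  prodR n f * g k = prodR n g * f k.
Proof.
  induction n as [|n IH]; intros Hk H; [lia|simpl].
  destruct (Nat.eq_dec k n) as [->|Hn].
  - rewrite (prodR_ext n f g); [lra|intros; apply H; lia].
  - rewrite (H n) by lia. transitivity (prodR n f * g k * g n); [lra|].
    rewrite IH; [lra|lia|intros; apply H; lia].
Qed.

Lemma prodR_mult n f g : prodR n (fun i => f i * g i) = prodR n f * prodR n g.
Proof. induction n as [|n IH]; simpl; [lra|rewrite IH; lra]. Qed.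

Lemma prodR_const n c : prodR n (fun _ => c) = c ^ n.
Proof. induction n as [|n IH]; simpl; [lra|rewrite IH; lra]. Qed.

Lemma prodR_nonneg n f : (forall i, (i < n)%nat -> 0 <= f i) -> 0 <= prodR n f.
Proof.
  induction n as [|n IH]; intros H; simpl; [lra|].
  apply Rmult_le_pos; [apply IH; intros; apply H; lia|apply H; lia].
Qed.

Lemma prodR_pos n f : (forall i, (i < n)%nat -> 0 < f i) -> 0 < prodR n f.
Proof.
  induction n as [|n IH]; intros H; simpl; [lra|].
  apply Rmult_lt_0_compat; [apply IH; intros; apply H; lia|apply H; lia].
Qed.

Lemma prodR_zero n f k : (k < n)%nat -> f k = 0 -> prodR n f = 0.
Proof.
  induction n as [|n IH]; intros Hk H; simpl; [lia|].
  destruct (Nat.eq_dec k n) as [->|Hn]; [rewrite H; lra|].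
  rewrite IH; [lra|lia|easy].
Qed.

(** * Families of boxes *)

Definition disjoint_boxes (m : nat) (b c : box) : Prop :=
  forall x, ~ (in_obox m b x /\ in_obox m c x).

(* [C] records where the open boxes lie, so that families living in disjoint
   containers can be concatenated. *)
Definition box_family (m : nat) (S C : (nat -> R) -> Prop) (bs : list box) : Prop :=
  (forall b, In b bs ->
     box_ok m b /\ (forall x, in_cbox m b x -> S x) /\ (forall x, in_obox m b x -> C x)) /\
  ForallOrdPairs (disjoint_boxes m) bs.

Definition total_vol (m : nat) (bs : list box) : R :=
  fold_right (fun b s => box_vol m b + s) 0 bs.

Definition sumL {I : Type} (f : I -> R) (l : list I) : R :=
  fold_right (fun i s => f i + s) 0 l.

Lemma total_vol_app m l1 l2 : total_vol m (l1 ++ l2) = total_vol m l1 + total_vol m l2.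
Proof. induction l1 as [|b l IH]; simpl; [lra|rewrite IH; lra]. Qed.

Lemma total_vol_flat_map {I} m (f : I -> list box) l :
  total_vol m (flat_map f l) = sumL (fun i => total_vol m (f i)) l.
Proof. induction l as [|b l IH]; simpl; [easy|]. now rewrite total_vol_app, IH. Qed.

Lemma sumL_le {I} (f g : I -> R) l : (forall i, In i l -> f i <= g i) -> sumL f l <= sumL g l.
Proof.
  induction l as [|a l IH]; intros H; simpl; [lra|].
  apply Rplus_le_compat; [apply H; now left|apply IH; intros; apply H; now right].
Qed.

Lemma sumL_scal {I} c (f : I -> R) l : sumL (fun i => c * f i) l = c * sumL f l.
Proof. induction l as [|a l IH]; simpl; [lra|rewrite IH; lra]. Qed.

Lemma sumL_seq f k n : sumL f (seq k n) = sumR n (fun i => f (k + i)%nat).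
Proof.
  revert k; induction n as [|n IH]; intros k; [easy|].
  rewrite sumR_shift. simpl. rewrite IH, Nat.add_0_r. f_equal.
  apply sumR_ext; intros; f_equal; lia.
Qed.

Lemma box_vol_nonneg m b : box_ok m b -> 0 <= box_vol m b.
Proof. intros H. apply prodR_nonneg. intros i Hi. specialize (H i Hi). lra. Qed.

Lemma FOP_app {T} (P : T -> T -> Prop) l1 l2 :
  ForallOrdPairs P l1 -> ForallOrdPairs P l2 ->
  (forall a b, In a l1 -> In b l2 -> P a b) -> ForallOrdPairs P (l1 ++ l2).
Proof.
  induction 1 as [|a l Ha Hl IH]; intros H2 H; simpl; [easy|].
  constructor.
  - apply Forall_app. split; [easy|]. apply Forall_forall. intros; apply H; simpl; auto.
  - apply IH; [easy|]. intros; apply H; simpl; auto.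
Qed.

Lemma box_family_concat {I} m S (C : I -> (nat -> R) -> Prop) (f : I -> list box) (l : list I) :
  (forall i, In i l -> box_family m S (C i) (f i)) ->
  ForallOrdPairs (fun i j => forall x, ~ (C i x /\ C j x)) l ->
  box_family m S (fun x => exists i, In i l /\ C i x) (flat_map f l).
Proof.
  intros H HC. split.
  - intros b Hb. apply in_flat_map in Hb. destruct Hb as (i & Hi & Hb).
    destruct (H i Hi) as [H1 _]. destruct (H1 b Hb) as (Ha & Hb' & Hc).
    split; [easy|split; [easy|]]. intros x Hx. exists i. auto.
  - induction HC as [|i l Hi Hl IH]; simpl; [constructor|].
    apply FOP_app.
    + apply H; now left.
    + apply IH. intros; apply H; now right.
    + intros b c Hb Hc x [Hbx Hcx]. apply in_flat_map in Hc. destruct Hc as (j & Hj & Hc).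
      rewrite Forall_forall in Hi. apply (Hi j Hj x). split.
      * apply (proj1 (H i (or_introl eq_refl)) b Hb). easy.
      * apply (proj1 (H j (or_intror Hj)) c Hc). easy.
Qed.

Lemma box_family_weaken m S S' C C' bs :
  (forall x, S x -> S' x) -> (forall x, C x -> C' x) ->
  box_family m S C bs -> box_family m S' C' bs.
Proof.
  intros HS HC [H1 H2]. split; [|easy]. intros b Hb. destruct (H1 b Hb) as (Ha & Hb' & Hc).
  repeat split; auto.
Qed.

Lemma FOP_seq M p : ForallOrdPairs (fun q q' : nat => (q < q')%nat) (seq p M).
Proof.
  revert p. induction M as [|M IH]; intros p; simpl; constructor; [|apply IH].
  apply Forall_forall. intros q Hq. apply in_seq in Hq. lia.
Qed.

Lemma FOP_nth {T} (P : T -> T -> Prop) d l :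
  (forall x y, P x y -> P y x) ->
  ForallOrdPairs P l ->
  forall j k, (j < length l)%nat -> (k < length l)%nat -> j <> k -> P (nth j l d) (nth k l d).
Proof.
  intros Psym H. induction H as [|a l Ha Hl IH]; intros j k Hj Hk Hjk; simpl in *; [lia|].
  rewrite Forall_forall in Ha.
  destruct j as [|j], k as [|k]; [lia| | |].
  - apply Ha, nth_In. lia.
  - apply Psym, Ha, nth_In. lia.
  - apply IH; lia.
Qed.

Lemma nth_FOP {T} (P : T -> T -> Prop) d l :
  (forall j k, (j < length l)%nat -> (k < length l)%nat -> j <> k -> P (nth j l d) (nth k l d)) ->
  ForallOrdPairs P l.
Proof.
  induction l as [|a l IH]; intros H; constructor.
  - apply Forall_forall. intros b Hb. destruct (In_nth l b d Hb) as (k & Hk & <-).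
    apply (H 0%nat (S k)); simpl; lia.
  - apply IH. intros j k Hj Hk Hjk. apply (H (S j) (S k)); simpl; lia.
Qed.

Lemma total_vol_nth m bs :
  total_vol m bs = sumR (length bs) (fun k => box_vol m (nth k bs dummy_box)).
Proof.
  induction bs as [|b bs IH]; [easy|].
  simpl length. rewrite sumR_shift. simpl. now rewrite IH.
Qed.

(** * Upper and lower bounds for inner content *)

Definition content_le (m : nat) (S : (nat -> R) -> Prop) (v : R) : Prop :=
  forall bs, box_family m S (fun _ => True) bs -> total_vol m bs <= v.

(** The error is relative, so it survives scaling by a determinant, and two errors of [eps / 2]
    combine into one of [eps]. *)
Definition content_ge (m : nat) (S : (nat -> R) -> Prop) (v : R) : Prop :=
  forall eps, 0 < eps < 1 -> exists bs,
    box_family m S (fun _ => True) bs /\ (1 - eps) * v <= total_vol m bs.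

(** [Rsup] is a choice among least upper bounds, so their uniqueness fixes its value. *)
Lemma inner_content_eq m S v :
  content_le m S v -> content_ge m S v -> 0 <= v -> inner_content m S = v.
Proof.
  intros Hle Hge Hv. unfold inner_content, Rsup.
  match goal with |- epsilon _ (fun v => is_lub ?E v) = _ => set (EE := E) end.
  assert (HE : forall r, EE r <-> exists bs, box_family m S (fun _ => True) bs /\ r = total_vol m bs).
  { intros r. split.
    - intros (bs & H1 & H2 & H3 & H4). exists bs. split; [|now rewrite total_vol_nth].
      split.
      + intros b Hb. destruct (In_nth bs b dummy_box Hb) as (k & Hk & <-).
        split; [now apply H1|]. split; [now apply H2|easy].
      + apply nth_FOP with dummy_box. exact H3.
    - intros (bs & [H1 H2] & ->). exists bs. rewrite <- total_vol_nth.
      split; [|split; [|split; [|easy]]].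
      + intros k Hk. exact (proj1 (H1 _ (nth_In _ _ Hk))).
      + intros k Hk. exact (proj1 (proj2 (H1 _ (nth_In _ _ Hk)))).
      + apply (FOP_nth (disjoint_boxes m)); [|easy].
        intros x y H z [Hz1 Hz2]. now apply (H z). }
  assert (Hlub : is_lub EE v).
  { split.
    - intros r Hr. apply HE in Hr. destruct Hr as (bs & Hb & ->). auto.
    - intros c Hc. destruct (Rle_or_lt v c) as [|Hlt]; [easy|exfalso].
      assert (Hc0 : 0 <= c).
      { apply Hc, HE. exists []. split; [|easy]. split; [easy|constructor]. }
      assert (Hv0 : 0 < v) by lra.
      (* This [eps] makes [(1 - eps) * v] the midpoint of [c] and [v], above the supposed bound
         [c]. *)
      destruct (Hge ((v - c) / (2 * v))) as (bs & Hb & Ht).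
      { split; [apply Rdiv_lt_0_compat; lra|].
        apply Rmult_lt_reg_r with (2 * v); [lra|]. unfold Rdiv.
        rewrite Rmult_assoc, Rinv_l; lra. }
      assert (total_vol m bs <= c) by (apply Hc, HE; eauto).
      replace ((1 - (v - c) / (2 * v)) * v) with ((v + c) / 2) in Ht by (field; lra).
      lra. }
  apply (is_lub_u EE); [|exact Hlub].
  apply epsilon_spec. now exists v.
Qed.

(** * Maps of known volume distortion *)

(* For an affine map [g] this will hold with [d] the inverse of its determinant;
   [g] is read backwards: families are built in preimages of boxes. *)
Definition expands (m : nat) (g : (nat -> R) -> nat -> R) (d : R) : Prop :=
  forall b, box_ok m b -> forall eps, 0 < eps < 1 -> exists bs,
    box_family m (fun x => in_cbox m b (g x)) (fun x => in_obox m b (g x)) bs /\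
    (1 - eps) * (d * box_vol m b) <= total_vol m bs.

(** Preimages of disjoint open boxes are disjoint, so the families found inside the preimages of the
    boxes of [bs] can be joined. *)
Lemma expands_family m g d S bs eps :
  expands m g d -> box_family m S (fun _ => True) bs -> 0 < eps < 1 ->
  exists bs', box_family m (fun x => S (g x)) (fun _ => True) bs' /\
    (1 - eps) * (d * total_vol m bs) <= total_vol m bs'.
Proof.
  intros Hg [H1 H2] He.
  pose (f := fun b => epsilon (inhabits (@nil box)) (fun bs =>
    box_family m (fun x => in_cbox m b (g x)) (fun x => in_obox m b (g x)) bs /\
    (1 - eps) * (d * box_vol m b) <= total_vol m bs)).
  assert (Hf : forall b, In b bs ->
    box_family m (fun x => in_cbox m b (g x)) (fun x => in_obox m b (g x)) (f b) /\
    (1 - eps) * (d * box_vol m b) <= total_vol m (f b)).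
  { intros b Hb. apply (epsilon_spec (inhabits (@nil box))). apply Hg; [|easy]. now apply H1. }
  exists (flat_map f bs). split.
  - apply box_family_weaken with (S := fun x => S (g x))
      (C := fun x => exists b, In b bs /\ in_obox m b (g x)); [easy|easy|].
    apply (box_family_concat m _ (fun b x => in_obox m b (g x))).
    + intros b Hb. apply box_family_weaken with (3 := proj1 (Hf b Hb)); [|easy].
      intros x. apply H1. exact Hb.
    + clear -H2. induction H2 as [|b l Hb Hl IH]; constructor; [|easy].
      apply Forall_impl with (2 := Hb). intros c Hc x. apply Hc.
  - rewrite total_vol_flat_map, <- !Rmult_assoc.
    change (total_vol m bs) with (sumL (box_vol m) bs).
    rewrite <- sumL_scal. apply sumL_le. intros b Hb. rewrite Rmult_assoc. now apply Hf.
Qed.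

(** The box is filled along [g1], then each resulting box along [g2]. Each stage loses [eps / 2],
    and [(1 - eps / 2)^2 >= 1 - eps]. *)
Lemma expands_comp m g1 d1 g2 d2 :
  expands m g1 d1 -> expands m g2 d2 -> 0 <= d1 -> 0 <= d2 ->
  expands m (fun x => g1 (g2 x)) (d1 * d2).
Proof.
  intros H1 H2 P1 P2 b Hb eps He.
  destruct (H1 b Hb (eps / 2)) as (bs & [Hb1 Hb2] & Hv); [lra|].
  pose (f := fun b => epsilon (inhabits (@nil box)) (fun bs =>
    box_family m (fun x => in_cbox m b (g2 x)) (fun x => in_obox m b (g2 x)) bs /\
    (1 - eps / 2) * (d2 * box_vol m b) <= total_vol m bs)).
  assert (Hf : forall b, In b bs ->
    box_family m (fun x => in_cbox m b (g2 x)) (fun x => in_obox m b (g2 x)) (f b) /\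
    (1 - eps / 2) * (d2 * box_vol m b) <= total_vol m (f b)).
  { intros c Hc. apply (epsilon_spec (inhabits (@nil box))). apply H2; [|lra]. now apply Hb1. }
  exists (flat_map f bs). split.
  - apply box_family_weaken with (S := fun x => in_cbox m b (g1 (g2 x)))
      (C := fun x => exists c, In c bs /\ in_obox m c (g2 x)).
    + easy.
    + intros x (c & Hc & Hx). now apply (proj2 (proj2 (Hb1 c Hc))).
    + apply (box_family_concat m _ (fun b x => in_obox m b (g2 x))).
      * intros c Hc. apply box_family_weaken with (3 := proj1 (Hf c Hc)); [|easy].
        intros x. apply Hb1. exact Hc.
      * clear -Hb2. induction Hb2 as [|c l Hc Hl IH]; constructor; [|easy].
        apply Forall_impl with (2 := Hc). intros c' Hc' x. apply Hc'.
  - rewrite total_vol_flat_map.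
    apply Rle_trans with (sumL (fun c => (1 - eps / 2) * d2 * box_vol m c) bs).
    + rewrite sumL_scal. change (sumL (box_vol m) bs) with (total_vol m bs).
      apply Rle_trans with ((1 - eps / 2) * d2 * ((1 - eps / 2) * (d1 * box_vol m b))).
      * pose proof (Rmult_le_pos _ _ (Rmult_le_pos _ _ P1 P2) (box_vol_nonneg m b Hb)).
        replace ((1 - eps / 2) * d2 * ((1 - eps / 2) * (d1 * box_vol m b)))
          with (((1 - eps / 2) * (1 - eps / 2)) * (d1 * d2 * box_vol m b)) by ring.
        apply Rmult_le_compat_r; [easy|nra].
      * apply Rmult_le_compat_l; [|easy]. apply Rmult_le_pos; lra.
    + apply sumL_le. intros c Hc. rewrite Rmult_assoc. now apply Hf.
Qed.

Lemma expands_ext m g g' d :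
  (forall x i, (i < m)%nat -> g x i = g' x i) -> expands m g d -> expands m g' d.
Proof.
  intros H Hg b Hb eps He. destruct (Hg b Hb eps He) as (bs & Hbs & Hv).
  exists bs. split; [|easy].
  apply box_family_weaken with (3 := Hbs);
    intros x Hx i Hi; rewrite <- H by easy; now apply Hx.
Qed.

Lemma content_ge_expands m g d S S' v :
  expands m g d -> 0 <= d -> 0 <= v -> (forall x, S (g x) -> S' x) ->
  content_ge m S v -> content_ge m S' (d * v).
Proof.
  intros Hg Hd Hv0 HS HSv eps He.
  destruct (HSv (eps / 2)) as (bs & Hbs & Hv); [lra|].
  destruct (expands_family m g d S bs (eps / 2) Hg Hbs) as (bs' & Hbs' & Hv'); [lra|].
  exists bs'. split.
  - apply box_family_weaken with (3 := Hbs'); auto.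
  - apply Rle_trans with (2 := Hv').
    apply Rle_trans with ((1 - eps / 2) * (d * ((1 - eps / 2) * v))).
    + replace ((1 - eps / 2) * (d * ((1 - eps / 2) * v)))
        with (((1 - eps / 2) * (1 - eps / 2)) * (d * v)) by ring.
      apply Rmult_le_compat_r; [now apply Rmult_le_pos|nra].
    + apply Rmult_le_compat_l; [lra|]. now apply Rmult_le_compat_l.
Qed.

(** An upper bound from a lower estimate: a family in [S'] exceeding [v / d] would pull back along
    [g] to a family in [S] exceeding [v]. *)
Lemma content_le_expands m g d S S' v :
  expands m g d -> 0 < d -> (forall x, S' (g x) -> S x) ->
  content_le m S v -> content_le m S' (v / d).
Proof.
  intros Hg Hd HS HSv bs Hbs.
  apply Rmult_le_reg_r with d; [easy|].
  replace (v / d * d) with v by (field; lra).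
  apply Rnot_lt_le. intros Hlt.
  assert (H0 : 0 <= v).
  { apply (HSv nil). split; [easy|constructor]. }
  set (T := total_vol m bs) in *.
  assert (HT : 0 < T * d) by lra.
  (* With this error the pulled-back volume is at least the midpoint of [T * d] and [v]. *)
  destruct (expands_family m g d S' bs ((T * d - v) / (2 * (T * d))) Hg Hbs) as (bs' & Hbs' & Hv').
  { split; [apply Rdiv_lt_0_compat; lra|].
    apply Rmult_lt_reg_r with (2 * (T * d)); [lra|]. unfold Rdiv.
    rewrite Rmult_assoc, Rinv_l; lra. }
  fold T in Hv'.
  assert (total_vol m bs' <= v).
  { apply HSv. apply box_family_weaken with (3 := Hbs'); auto. }
  replace ((1 - (T * d - v) / (2 * (T * d))) * (d * T)) with ((T * d + v) / 2) in Hv'.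
  - lra.
  - field. split; nra.
Qed.

(** * Translations, scalings and shears *)

Definition upd (x : nat -> R) (k : nat) (v : R) : nat -> R :=
  fun i => if Nat.eqb i k then v else x i.

Lemma upd_eq x k v : upd x k v k = v.
Proof. unfold upd. now rewrite Nat.eqb_refl. Qed.

Lemma upd_neq x k v i : i <> k -> upd x k v i = x i.
Proof. intros H. unfold upd. now apply Nat.eqb_neq in H as ->. Qed.

Lemma box_family_nil m S C : box_family m S C [].
Proof. split; [easy|constructor]. Qed.

Lemma box_family_single m S C b :
  box_ok m b -> (forall x, in_cbox m b x -> S x) -> (forall x, in_obox m b x -> C x) ->
  box_family m S C [b].
Proof.
  intros H1 H2 H3. split.
  - intros b' [<-|[]]. auto.
  - repeat constructor.
Qed.

(** For maps under which the preimage of a box is again a box, such as translations, scalings and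
    permutations; one box then suffices. *)
Lemma expands_by_box m g d :
  0 <= d ->
  (forall b, box_ok m b -> exists b', box_ok m b' /\
     (forall x, in_cbox m b' x -> in_cbox m b (g x)) /\
     (forall x, in_obox m b' x -> in_obox m b (g x)) /\
     box_vol m b' = d * box_vol m b) ->
  expands m g d.
Proof.
  intros Hd H b Hb eps He. destruct (H b Hb) as (b' & H1 & H2 & H3 & H4).
  exists [b']. split; [now apply box_family_single|].
  simpl. rewrite H4.
  pose proof (Rmult_le_pos _ _ Hd (box_vol_nonneg m b Hb)). nra.
Qed.

Lemma expands_id m : expands m (fun x => x) 1.
Proof.
  apply expands_by_box; [lra|]. intros b Hb. exists b. repeat split; try apply H; auto. lra.
Qed.

Lemma expands_translate m c : expands m (fun x i => x i + c i) 1.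
Proof.
  apply expands_by_box; [lra|]. intros b Hb.
  exists ((fun i => fst b i - c i), (fun i => snd b i - c i)).
  split; [|split; [|split]].
  - intros i Hi. specialize (Hb i Hi). simpl. lra.
  - intros x Hx i Hi. specialize (Hx i Hi). simpl in Hx. lra.
  - intros x Hx i Hi. specialize (Hx i Hi). simpl in Hx. lra.
  - unfold box_vol. simpl. rewrite Rmult_1_l. apply prodR_ext. intros; lra.
Qed.

Lemma expands_scale m k r :
  (k < m)%nat -> r <> 0 -> expands m (fun x => upd x k (r * x k)) (/ Rabs r).
Proof.
  intros Hk Hr. pose proof (Rabs_pos_lt r Hr) as Hr'.
  apply expands_by_box; [left; now apply Rinv_0_lt_compat|]. intros b Hb.
  set (lo := Rmin (fst b k / r) (snd b k / r)). set (hi := Rmax (fst b k / r) (snd b k / r)).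
  assert (Hk' := Hb k Hk).
  (* A negative [r] swaps the two ends of the interval. *)
  assert (H : (0 < r /\ lo = fst b k / r /\ hi = snd b k / r /\ Rabs r = r) \/
              (r < 0 /\ lo = snd b k / r /\ hi = fst b k / r /\ Rabs r = - r)).
  { unfold lo, hi. destruct (Rtotal_order r 0) as [H|[H|H]]; [right|lra|left].
    - assert (snd b k / r <= fst b k / r).
      { unfold Rdiv. apply Rmult_le_compat_neg_l with (r := / r) in Hk'; [lra|].
        left. now apply Rinv_lt_0_compat. }
      rewrite Rmin_right, Rmax_left, Rabs_left; auto.
    - assert (fst b k / r <= snd b k / r).
      { unfold Rdiv. apply Rmult_le_compat_r; [|easy]. left. now apply Rinv_0_lt_compat. }
      rewrite Rmin_left, Rmax_right, Rabs_right; auto; lra. }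
  exists (upd (fst b) k lo, upd (snd b) k hi).
  split; [|split; [|split]].
  - intros i Hi. simpl. destruct (Nat.eq_dec i k) as [->|Hn].
    + rewrite !upd_eq. unfold lo, hi. apply Rminmax.
    + rewrite !upd_neq by easy. now apply Hb.
  - intros x Hx i Hi. specialize (Hx i Hi). simpl in Hx.
    destruct (Nat.eq_dec i k) as [->|Hn].
    + rewrite !upd_eq in *. destruct H as [(H & H1 & H2 & _)|(H & H1 & H2 & _)];
        rewrite H1, H2 in Hx; destruct Hx as [Ha Hc];
        [apply Rmult_le_compat_l with (r := r) in Ha, Hc; try lra
        |apply Rmult_le_compat_neg_l with (r := r) in Ha, Hc; try lra];
        unfold Rdiv in *; rewrite <- !Rmult_assoc, !Rinv_r_simpl_m in *; lra.
    + rewrite !upd_neq in * by easy. easy.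
  - intros x Hx i Hi. specialize (Hx i Hi). simpl in Hx.
    destruct (Nat.eq_dec i k) as [->|Hn].
    + rewrite !upd_eq in *. destruct H as [(H & H1 & H2 & _)|(H & H1 & H2 & _)];
        rewrite H1, H2 in Hx; destruct Hx as [Ha Hc];
        [apply Rmult_lt_compat_l with (r := r) in Ha, Hc; try lra
        |apply Rmult_lt_gt_compat_neg_l with (r := r) in Ha, Hc; try lra];
        unfold Rdiv in *; rewrite <- !Rmult_assoc, !Rinv_r_simpl_m in *; lra.
    + rewrite !upd_neq in * by easy. easy.
  - unfold box_vol. simpl.
    assert (Hlen : hi - lo = (snd b k - fst b k) * / Rabs r).
    { destruct H as [(H & H1 & H2 & H3)|(H & H1 & H2 & H3)]; rewrite H1, H2, H3; field; lra. }
    assert (HU := prodR_update m (fun i => upd (snd b) k hi i - upd (fst b) k lo i)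
              (fun i => snd b i - fst b i) k Hk).
    simpl in HU. rewrite !upd_eq in HU.
    (* A box flat in direction [k] has volume zero on both sides; otherwise the side length can be
       cancelled. *)
    destruct (Req_dec (snd b k - fst b k) 0) as [H0|H0].
    + rewrite (prodR_zero m _ k Hk), (prodR_zero m (fun i => snd b i - fst b i) k Hk);
        [lra|easy|]. rewrite !upd_eq, Hlen, H0. lra.
    + apply Rmult_eq_reg_r with (snd b k - fst b k); [|easy].
      rewrite HU, Hlen; [ring|]. intros i Hi Hn. now rewrite !upd_neq.
Qed.

(** Side [j] of [b] is cut into [N] pieces of length [s]. The preimage of [b] under the shear adding
    [c * x_j] to [x_k] is slanted; over the piece starting at [p], an upright box fits into it once
    its [k]-side is shortened by [Rabs c * s] at both ends. *)
Definition slab_box (b : box) (j k : nat) (c : R) (N q : nat) : box :=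
  let s := (snd b j - fst b j) / INR N in
  let p := fst b j + INR q * s in
  (upd (upd (fst b) j p) k (fst b k - c * p + Rabs c * s),
   upd (upd (snd b) j (p + s)) k (snd b k - c * p - Rabs c * s)).

Lemma Rmult_Rabs_bound c x s : 0 <= x <= s -> - (Rabs c * s) <= c * x <= Rabs c * s.
Proof.
  intros Hx. assert (Rabs (c * x) <= Rabs c * s).
  { rewrite Rabs_mult, (Rabs_pos_eq x) by lra.
    apply Rmult_le_compat_l; [apply Rabs_pos|lra]. }
  pose proof (Rle_abs (c * x)). pose proof (Rle_abs (- (c * x))). rewrite Rabs_Ropp in *. lra.
Qed.

Lemma expands_shear m j k c :
  (j < m)%nat -> (k < m)%nat -> j <> k ->
  expands m (fun x => upd x k (x k + c * x j)) 1.
Proof.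
  intros Hj Hk Hjk b Hb eps He.
  destruct (Req_dec (box_vol m b) 0) as [H0|H0].
  { exists []. split; [apply box_family_nil|]. rewrite H0. simpl. lra. }
  assert (Hpos : forall i, (i < m)%nat -> fst b i < snd b i).
  { intros i Hi. destruct (Hb i Hi) as [|E]; [easy|exfalso]. apply H0.
    apply (prodR_zero m _ i Hi). lra. }
  set (w := snd b j - fst b j). set (h := snd b k - fst b k).
  assert (Hw : 0 < w) by (specialize (Hpos j Hj); unfold w; lra).
  assert (Hh : 0 < h) by (specialize (Hpos k Hk); unfold h; lra).
  assert (Hc := Rabs_pos c).
  (* [N] is large enough for the height [2 * Rabs c * s] lost in each slab to be at most
     [eps * h]. *)
  destruct (INR_unbounded (2 * Rabs c * w / (h * eps) + 1)) as (N & HN).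
  assert (Hq : 0 <= 2 * Rabs c * w / (h * eps)).
  { unfold Rdiv. apply Rmult_le_pos; [nra|]. left. apply Rinv_0_lt_compat. nra. }
  assert (HN0 : 0 < INR N) by lra.
  set (s := w / INR N).
  assert (Hs : 0 < s) by (now apply Rdiv_lt_0_compat).
  assert (Hbnd : 2 * Rabs c * s <= eps * h).
  { unfold s. apply Rmult_le_reg_r with (INR N / (h * eps)); [apply Rdiv_lt_0_compat; nra|].
    replace (2 * Rabs c * (w / INR N) * (INR N / (h * eps))) with (2 * Rabs c * w / (h * eps))
      by (field; lra).
    replace (eps * h * (INR N / (h * eps))) with (INR N) by (field; lra). lra. }
  exists (flat_map (fun q => [slab_box b j k c N q]) (seq 0 N)). split.
  - apply box_family_weaken with (S := fun x => in_cbox m b (upd x k (x k + c * x j)))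
      (C := fun x => exists q, In q (seq 0 N) /\
         (fst b j + INR q * s < x j < fst b j + INR q * s + s /\
          in_obox m b (upd x k (x k + c * x j)))); [easy|now intros x (q & _ & _ & H)|].
    apply (box_family_concat m _ (fun q x =>
         fst b j + INR q * s < x j < fst b j + INR q * s + s /\
          in_obox m b (upd x k (x k + c * x j)))).
    + intros q Hq'. apply in_seq in Hq'.
      assert (Hq1 : INR q * s + s <= w).
      { assert (HqN : INR (S q) <= INR N) by (apply le_INR; lia). rewrite S_INR in HqN.
        replace w with (INR N * s) by (unfold s; field; lra). nra. }
      assert (Hq2 : 0 <= INR q * s) by (apply Rmult_le_pos; [apply pos_INR|lra]).
      apply box_family_single.
      * intros i Hi. unfold slab_box. fold w s. simpl.
        destruct (Nat.eq_dec i k) as [->|Hik]; [rewrite !upd_eq; fold h; unfold h in *; nra|].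
        rewrite !(upd_neq _ k) by easy.
        destruct (Nat.eq_dec i j) as [->|Hij]; [rewrite !upd_eq; lra|].
        rewrite !upd_neq by easy. now apply Hb.
      * intros x Hx i Hi. assert (Hxi := Hx i Hi). assert (Hxj := Hx j Hj).
        unfold slab_box in *. fold w s in Hxi, Hxj. simpl in *.
        rewrite !(upd_neq _ k _ j), !upd_eq in Hxj by easy.
        destruct (Nat.eq_dec i k) as [->|Hik].
        -- rewrite !upd_eq in *.
           assert (HB := Rmult_Rabs_bound c (x j - (fst b j + INR q * s)) s ltac:(lra)).
           lra.
        -- rewrite !(upd_neq _ k) in * by easy.
           destruct (Nat.eq_dec i j) as [->|Hij]; [unfold w in *; lra|].
           now rewrite !upd_neq in Hxi by easy.
      * intros x Hx. assert (Hxj := Hx j Hj). unfold slab_box in Hx, Hxj.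
        fold w s in Hx, Hxj. simpl in Hx, Hxj.
        rewrite !(upd_neq _ k _ j), !upd_eq in Hxj by easy. split; [easy|].
        intros i Hi. assert (Hxi := Hx i Hi). simpl in Hxi.
        destruct (Nat.eq_dec i k) as [->|Hik].
        -- rewrite !upd_eq in *.
           assert (HB := Rmult_Rabs_bound c (x j - (fst b j + INR q * s)) s ltac:(lra)).
           lra.
        -- rewrite !(upd_neq _ k) in * by easy.
           destruct (Nat.eq_dec i j) as [->|Hij]; [unfold w in *; lra|].
           now rewrite !upd_neq in Hxi by easy.
    + assert (HS := FOP_seq N 0). clear -HS Hs.
      induction HS as [|q l Hq Hl IH]; constructor; [|easy].
      apply Forall_impl with (2 := Hq). intros q' Hqq x [[H1 _] [H2 _]].
      assert (HqN : INR (S q) <= INR q') by (apply le_INR; lia). rewrite S_INR in HqN. nra.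
  - rewrite total_vol_flat_map.
    apply Rle_trans with (sumL (fun _ => box_vol m b * ((h - 2 * Rabs c * s) / h) / INR N) (seq 0 N)).
    + rewrite sumL_seq, sumR_const.
      replace (INR N * (box_vol m b * ((h - 2 * Rabs c * s) / h) / INR N))
        with (((h - 2 * Rabs c * s) / h) * box_vol m b) by (field; lra).
      rewrite Rmult_1_l. apply Rmult_le_compat_r; [now apply box_vol_nonneg|].
      apply Rmult_le_reg_r with h; [easy|]. unfold Rdiv. rewrite Rmult_assoc, Rinv_l; lra.
    + apply sumL_le. intros q _. simpl. rewrite Rplus_0_r. right.
      (* The volume changes in two stages: side [j] shrinks from [w] to [s], giving [V1], then side
         [k] from [h] to [h - 2 * Rabs c * s], giving [V2]. *)
      set (p := fst b j + INR q * s).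
      assert (H1 := prodR_update m
        (fun i => upd (snd b) j (p + s) i - upd (fst b) j p i) (fun i => snd b i - fst b i) j Hj).
      assert (H2 := prodR_update m
        (fun i => snd (slab_box b j k c N q) i - fst (slab_box b j k c N q) i)
        (fun i => upd (snd b) j (p + s) i - upd (fst b) j p i) k Hk).
      unfold slab_box in *. fold w s p in H2 |- *. unfold box_vol. simpl in *.
      rewrite !(upd_neq _ j _ k), !upd_eq in * by (auto; fail).
      fold w in H1. fold h in H2.
      match type of H2 with _ -> ?P1 * _ = ?P2 * _ => set (V2 := P1) in *; set (V1 := P2) in * end.
      set (V := prodR m (fun i => snd b i - fst b i)) in *.
      assert (H1' : V1 * w = V * s).
      { rewrite H1; [ring|]. intros i Hi Hn. now rewrite !upd_neq by easy. }
      assert (H2' : V2 * h = V1 * (h - 2 * Rabs c * s)).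
      { rewrite H2; [unfold h; ring|]. intros i Hi Hn. now rewrite !(upd_neq _ k) by easy. }
      apply Rmult_eq_reg_r with (h * w); [|nra].
      transitivity (V * s * (h - 2 * Rabs c * s)).
      * unfold s. field. lra.
      * rewrite <- H1'. replace (V2 * (h * w)) with (V2 * h * w) by ring. rewrite H2'. ring.
Qed.

(** * The standard simplex *)

Definition simplex (m : nat) (s : R) (z : nat -> R) : Prop :=
  (forall i, (i < m)%nat -> 0 <= z i) /\ sumR m z <= s.

(** Strict on both sides, so that slices at height [y] of boxes with disjoint interiors again have
    disjoint interiors. *)
Definition crosses (m : nat) (y : R) (b : box) : bool :=
  if Rlt_dec (fst b m) y then if Rlt_dec y (snd b m) then true else false else false.

Lemma crosses_spec m y b : crosses m y b = true <-> fst b m < y < snd b m.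
Proof.
  unfold crosses. destruct (Rlt_dec (fst b m) y), (Rlt_dec y (snd b m));
    split; intros; try easy; lra.
Qed.

Lemma is_RInt_crosses m (b : box) (c lo hi : R) :
  lo <= fst b m <= snd b m -> snd b m <= hi ->
  is_RInt (fun y => if crosses m y b then c else 0) lo hi (c * (snd b m - fst b m)).
Proof.
  intros H1 H2.
  assert (E : forall u v r : R, u <= v ->
     (forall y, u < y < v -> (if crosses m y b then c else 0) = r) ->
     is_RInt (fun y => if crosses m y b then c else 0) u v ((v - u) * r)).
  { intros u v r Huv H. apply is_RInt_ext with (fun _ => r); [|exact (is_RInt_const u v r)].
    intros y Hy. rewrite Rmin_left, Rmax_right in Hy by easy. symmetry. now apply H. }
  replace (c * (snd b m - fst b m)) with
    (plus (plus ((fst b m - lo) * 0) ((snd b m - fst b m) * c)) ((hi - snd b m) * 0))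
    by (unfold plus; simpl; ring).
  apply (is_RInt_Chasles (V := R_NormedModule)) with (snd b m);
    [apply (is_RInt_Chasles (V := R_NormedModule)) with (fst b m)|];
    (apply E; [lra|intros y Hy]); destruct (crosses m y b) eqn:Hc; try easy.
  - apply crosses_spec in Hc. lra.
  - assert (crosses m y b = true) by (now apply crosses_spec). congruence.
  - apply crosses_spec in Hc. lra.
Qed.

(** Fubini for a finite family of boxes, by additivity. *)
Lemma is_RInt_slices m bs lo hi :
  (forall b, In b bs -> lo <= fst b m <= snd b m /\ snd b m <= hi) ->
  is_RInt (fun y => total_vol m (filter (crosses m y) bs)) lo hi (total_vol (S m) bs).
Proof.
  induction bs as [|b bs IH]; intros H.
  - simpl. assert (E := is_RInt_const lo hi 0). unfold scal in E. simpl in E. unfold mult in E.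
    simpl in E. now rewrite Rmult_0_r in E.
  - apply is_RInt_ext with (fun y => plus (if crosses m y b then box_vol m b else 0)
                                          (total_vol m (filter (crosses m y) bs))).
    + intros y _. unfold plus. simpl. destruct (crosses m y b); simpl; ring.
    + apply (is_RInt_plus (V := R_NormedModule)).
      * apply is_RInt_crosses; apply H; now left.
      * apply IH. intros; apply H; now right.
Qed.

Lemma FOP_filter {T} (P Q : T -> T -> Prop) f (l : list T) :
  (forall a b, f a = true -> f b = true -> P a b -> Q a b) ->
  ForallOrdPairs P l -> ForallOrdPairs Q (filter f l).
Proof.
  intros HPQ H. induction H as [|a l Ha Hl IH]; simpl; [constructor|].
  destruct (f a) eqn:Hf; [|easy]. constructor; [|easy].
  apply Forall_forall. intros b Hb. apply filter_In in Hb. rewrite Forall_forall in Ha.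
  apply HPQ; try easy. now apply Ha.
Qed.

Lemma sumR_upd m x y : sumR m (upd x m y) = sumR m x.
Proof. apply sumR_ext. intros. apply upd_neq. lia. Qed.

(** Induction on the dimension: the slice at height [y] lies in the simplex of size [s - y], and
    [(s - y)^m / m!] integrates to the next value. *)
Lemma content_le_simplex m : forall s, 0 <= s -> content_le m (simplex m s) (s ^ m / INR (fact m)).
Proof.
  induction m as [|m IH]; intros s Hs bs [H1 H2].
  (* In dimension 0 a box has volume 1, the empty product, and any two boxes overlap, so there is at
     most one. *)
  - simpl. destruct bs as [|b [|c bs]]; simpl; unfold box_vol; simpl; [lra|lra|].
    exfalso. inversion H2 as [|? ? Hb _]. subst. inversion Hb as [|? ? Hbc _].
    apply (Hbc (fun _ => 0)). split; intros i Hi; lia.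
  - assert (Hr : forall b, In b bs -> 0 <= fst b m <= snd b m /\ snd b m <= s).
    { intros b Hb. destruct (H1 b Hb) as (Hok & Hin & _).
      split; [split|].
      - apply (Hin (fst b)); [|lia]. intros i Hi. specialize (Hok i Hi). lra.
      - apply Hok. lia.
      - destruct (Hin (snd b)) as [Hp Hsum]. { intros i Hi. specialize (Hok i Hi). lra. }
        simpl in Hsum. assert (0 <= sumR m (snd b)).
        { apply sumR_nonneg. intros; apply Hp; lia. } lra. }
    set (F := fun y : R => (s - y) ^ m / INR (fact m)).
    set (G := fun y : R => - ((s - y) ^ (S m) / INR (fact (S m)))).
    assert (Hf := INR_fact_neq_0 m). assert (HSm := not_0_INR (S m) ltac:(lia)).
    assert (HF : is_RInt F 0 s (s ^ S m / INR (fact (S m)))).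
    { replace (s ^ S m / INR (fact (S m))) with (minus (G s) (G 0)).
      - apply (is_RInt_derive G F).
        + intros x _. unfold G, F. auto_derive; [easy|].
          change (match m with 0%nat => 1 | S _ => INR m + 1 end) with (INR (S m)).
          change (fact m + m * fact m)%nat with (S m * fact m)%nat.
          rewrite mult_INR. fold (s - x). field. easy.
        + intros x _. apply (@ex_derive_continuous R_AbsRing R_NormedModule).
          unfold F. auto_derive. easy.
      - unfold G, minus, plus, opp. simpl plus. rewrite Rminus_diag, Rminus_0_r, pow_i by lia.
        unfold Rdiv. simpl. ring. }
    apply (is_RInt_le _ _ 0 s _ _ Hs (is_RInt_slices m bs 0 s Hr) HF).
    intros y Hy. unfold F. apply IH; [lra|]. split.
    + intros b Hb. apply filter_In in Hb. destruct Hb as [Hb Hc]. apply crosses_spec in Hc.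
      destruct (H1 b Hb) as (Hok & Hin & _). split; [|split; [|easy]].
      * intros i Hi. apply Hok. lia.
      * intros x Hx. destruct (Hin (upd x m y)) as [Hp Hsum].
        -- intros i Hi. destruct (Nat.eq_dec i m) as [->|Hn]; [rewrite upd_eq; lra|].
           rewrite upd_neq by easy. apply Hx. lia.
        -- simpl in Hsum. rewrite upd_eq, sumR_upd in Hsum. split; [|lra].
           intros i Hi. specialize (Hp i). rewrite upd_neq in Hp by lia. apply Hp. lia.
    + apply FOP_filter with (2 := H2). intros b c Hb Hc Hbc x [Hxb Hxc].
      apply crosses_spec in Hb, Hc. apply (Hbc (upd x m y)).
      split; intros i Hi; (destruct (Nat.eq_dec i m) as [->|Hn];
        [rewrite upd_eq; lra|rewrite upd_neq by easy]); [apply Hxb|apply Hxc]; lia.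
Qed.

Lemma pow_diff_le m j : (INR j + 1) ^ (S m) - INR j ^ (S m) <= INR (S m) * (INR j + 1) ^ m.
Proof.
  assert (Hj := pos_INR j). induction m as [|m IH]; [simpl; lra|].
  rewrite S_INR. change ((INR j + 1) ^ S (S m)) with ((INR j + 1) * (INR j + 1) ^ S m).
  change (INR j ^ S (S m)) with (INR j * INR j ^ S m).
  assert (0 <= (INR j + 1) ^ m) by (apply pow_le; lra).
  assert (HE : (INR j + 1) ^ S m = (INR j + 1) * (INR j + 1) ^ m) by easy.
  assert (INR j * ((INR j + 1) ^ S m - INR j ^ S m) <= INR j * (INR (S m) * (INR j + 1) ^ m)).
  { now apply Rmult_le_compat_l. }
  assert (0 <= INR (S m) * (INR j + 1) ^ m) by (apply Rmult_le_pos; [apply pos_INR|easy]).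
  nra.
Qed.

(** Telescoped [pow_diff_le]: the Riemann-sum form of the integral of [x^m]. *)
Lemma sumR_pow_ge m N : INR N ^ (S m) <= INR (S m) * sumR N (fun j => INR (S j) ^ m).
Proof.
  induction N as [|N IH]; [simpl; lra|].
  change (sumR (S N) (fun j => INR (S j) ^ m)) with (sumR N (fun j => INR (S j) ^ m) + INR (S N) ^ m).
  assert (H := pow_diff_le m N). rewrite (S_INR N). lra.
Qed.

Lemma sumR_rev n f : sumR n f = sumR n (fun i => f (n - 1 - i)%nat).
Proof.
  induction n as [|n IH]; [easy|]. rewrite (sumR_shift n (fun i => f (S n - 1 - i)%nat)). simpl sumR.
  rewrite IH, Rplus_comm. f_equal; [f_equal; lia|].
  apply sumR_ext. intros. f_equal. lia.
Qed.

Definition raise_box (m : nat) (lo hi : R) (b : box) : box := (upd (fst b) m lo, upd (snd b) m hi).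

Lemma box_vol_raise m lo hi b : box_vol (S m) (raise_box m lo hi b) = box_vol m b * (hi - lo).
Proof.
  unfold box_vol. simpl. rewrite !upd_eq. f_equal. apply prodR_ext.
  intros. rewrite !upd_neq by lia. easy.
Qed.

(** The simplex is cut into [K] layers along the last coordinate. On layer [q] stand prisms over a
    good family in the simplex of size [lev q], the cross-section at the top of the layer and hence
    the smallest there. Half of [eps] pays for these families, the other half for the Riemann
    sum. *)
Lemma content_ge_simplex m : forall s, 0 <= s -> content_ge m (simplex m s) (s ^ m / INR (fact m)).
Proof.
  induction m as [|m IH]; intros s Hs eps He.
  - exists [dummy_box]. split.
    + apply box_family_single; [intros i Hi; lia| |easy].
      intros x _. split; [intros; lia|simpl; lra].
    + simpl. unfold box_vol. simpl. lra.
  (* The number of layers makes [INR (S m) / K] at most [eps / 2], which bounds the loss in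
     [Hbern]. *)
  - destruct (INR_unbounded (2 * INR (S m) / eps + 1)) as (N0 & HN0).
    destruct N0 as [|N].
    { change (INR 0) with 0 in HN0. assert (0 <= 2 * INR (S m) / eps); [|lra].
      apply Rmult_le_pos; [assert (H := pos_INR (S m)); lra|]. left. now apply Rinv_0_lt_compat. }
    set (K := INR (S N)) in *.
    assert (HSm : 0 < INR (S m)) by (apply lt_0_INR; lia).
    assert (HK : 0 < K) by (apply lt_0_INR; lia).
    assert (HKe : 2 * INR (S m) <= eps * K).
    { assert (2 * INR (S m) / eps < K) by lra.
      apply Rmult_lt_compat_r with (r := eps) in H; [|lra].
      unfold Rdiv in H. rewrite Rmult_assoc, Rinv_l in H; lra. }
    assert (Hf := INR_fact_lt_0 m).
    set (lev := fun q => s * INR (N - q) / K).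
    assert (Hlev : forall q, 0 <= lev q).
    { intros q. unfold lev. apply Rmult_le_pos; [|left; now apply Rinv_0_lt_compat].
      apply Rmult_le_pos; [easy|apply pos_INR]. }
    pose (f := fun q => epsilon (inhabits (@nil box)) (fun bs =>
      box_family m (simplex m (lev q)) (fun _ => True) bs /\
      (1 - eps / 2) * (lev q ^ m / INR (fact m)) <= total_vol m bs)).
    assert (Hfq : forall q, box_family m (simplex m (lev q)) (fun _ => True) (f q) /\
      (1 - eps / 2) * (lev q ^ m / INR (fact m)) <= total_vol m (f q)).
    { intros q. apply (epsilon_spec (inhabits (@nil box))). apply IH; [easy|lra]. }
    pose (lo := fun q => s * INR q / K).
    assert (Hlo : forall q, lo (S q) = lo q + s / K).
    { intros q. unfold lo. rewrite S_INR. field. lra. }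
    assert (HsK : 0 <= s / K) by (apply Rmult_le_pos; [easy|left; now apply Rinv_0_lt_compat]).
    pose (g := fun q => map (raise_box m (lo q) (lo (S q))) (f q)).
    exists (flat_map g (seq 0 (S N))). split.
    + apply box_family_weaken with (S := simplex (S m) s)
        (C := fun x => exists q, In q (seq 0 (S N)) /\ lo q < x m < lo (S q)); [easy|easy|].
      apply (box_family_concat (S m) _ (fun q x => lo q < x m < lo (S q))).
      * intros q Hq. apply in_seq in Hq. destruct (Hfq q) as [[F1 F2] _]. split.
        -- intros b Hb. apply in_map_iff in Hb. destruct Hb as (b0 & <- & Hb0).
           destruct (F1 b0 Hb0) as (Hok & Hin & _). split; [|split].
           ++ intros i Hi. simpl. destruct (Nat.eq_dec i m) as [->|Hn].
              ** rewrite !upd_eq, Hlo. lra.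
              ** rewrite !upd_neq by easy. apply Hok. lia.
           ++ intros x Hx. destruct (Hin x) as [Hp Hsum].
              { intros i Hi. specialize (Hx i ltac:(lia)). simpl in Hx.
                rewrite !upd_neq in Hx by lia. easy. }
              specialize (Hx m ltac:(lia)). simpl in Hx. rewrite !upd_eq in Hx. split.
              ** intros i Hi. destruct (Nat.eq_dec i m) as [->|Hn]; [|apply Hp; lia].
                 assert (0 <= lo q); [|lra]. unfold lo.
                 apply Rmult_le_pos; [|left; now apply Rinv_0_lt_compat].
                 apply Rmult_le_pos; [easy|apply pos_INR].
              ** simpl. assert (lev q + lo (S q) = s); [|lra].
                 unfold lev, lo. rewrite minus_INR by lia. unfold K. rewrite !S_INR. field.
                 assert (0 <= INR N) by apply pos_INR. lra.
           ++ intros x Hx. specialize (Hx m ltac:(lia)). simpl in Hx. now rewrite !upd_eq in Hx.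
        -- unfold g. clear -F2. induction F2 as [|b l Hb Hl IHl]; simpl; constructor; [|easy].
           apply Forall_forall. intros c Hc. apply in_map_iff in Hc. destruct Hc as (c0 & <- & Hc0).
           rewrite Forall_forall in Hb. intros x [Hx1 Hx2]. apply (Hb c0 Hc0 x).
           split; intros i Hi; [specialize (Hx1 i ltac:(lia))|specialize (Hx2 i ltac:(lia))];
             simpl in *; rewrite !upd_neq in * by lia; easy.
      * assert (HS := FOP_seq (S N) 0). clear -HS Hs HK.
        induction HS as [|q l Hq Hl IH]; constructor; [|easy].
        apply Forall_impl with (2 := Hq). intros q' Hqq x [[_ H1] [H2 _]].
        assert (lo (S q) <= lo q'); [|lra].
        unfold lo. apply Rmult_le_compat_r; [left; now apply Rinv_0_lt_compat|].
        apply Rmult_le_compat_l; [easy|]. apply le_INR. lia.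
    + rewrite total_vol_flat_map.
      assert (Hg : forall q, total_vol (S m) (g q) = s / K * total_vol m (f q)).
      { intros q. unfold g. generalize (f q). intros l. induction l as [|b l IHl]; [simpl; ring|].
        simpl map. change (total_vol (S m) (raise_box m (lo q) (lo (S q)) b ::
          map (raise_box m (lo q) (lo (S q))) l)) with
          (box_vol (S m) (raise_box m (lo q) (lo (S q)) b) +
           total_vol (S m) (map (raise_box m (lo q) (lo (S q))) l)).
        rewrite IHl, box_vol_raise, Hlo. simpl. ring. }
      apply Rle_trans with
        (sumL (fun q => s / K * ((1 - eps / 2) * (lev q ^ m / INR (fact m)))) (seq 0 (S N))).
      2:{ apply sumL_le. intros q _. rewrite Hg. apply Rmult_le_compat_l; [easy|apply Hfq]. }
      set (cst := (1 - eps / 2) * (s ^ S m / (K ^ S m * INR (fact m)))).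
      assert (Hs' : 0 <= s ^ S m) by (now apply pow_le).
      assert (HKm : 0 < K ^ S m) by (now apply pow_lt).
      assert (Hcst : 0 <= cst).
      { apply Rmult_le_pos; [lra|]. apply Rmult_le_pos; [easy|].
        left. apply Rinv_0_lt_compat. now apply Rmult_lt_0_compat. }
      replace (sumL (fun q => s / K * ((1 - eps / 2) * (lev q ^ m / INR (fact m)))) (seq 0 (S N)))
        with (cst * sumR (S N) (fun j => INR j ^ m)).
      * assert (Hpow : INR N ^ S m <= INR (S m) * sumR (S N) (fun j => INR j ^ m)).
        { apply Rle_trans with (1 := sumR_pow_ge m N).
          apply Rmult_le_compat_l; [lra|]. rewrite sumR_shift.
          assert (0 <= INR 0 ^ m) by (apply pow_le; simpl; lra). lra. }
        assert (Hbern : (1 - eps / 2) * K ^ S m <= INR N ^ S m).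
        (* Bernoulli's inequality. *)
        { assert (HB : 1 - INR (S m) / K <= (1 - / K) ^ S m).
          { assert (HKi : 0 < / K <= 1).
            { split; [now apply Rinv_0_lt_compat|].
              rewrite <- Rinv_1. apply Rinv_le_contravar; [lra|].
              unfold K. rewrite S_INR. assert (H := pos_INR N). lra. }
            unfold Rdiv. generalize dependent (/ K). clear. intros k Hk.
            induction m as [|m IH]; [simpl; lra|].
            rewrite (S_INR (S m)). change ((1 - k) ^ S (S m)) with ((1 - k) * (1 - k) ^ S m).
            assert (HSm : 0 <= INR (S m)) by apply pos_INR.
            apply Rle_trans with ((1 - k) * (1 - INR (S m) * k)); [nra|].
            apply Rmult_le_compat_l; lra. }
          assert (HN : INR N = (1 - / K) * K).
          { unfold K. rewrite S_INR. field. rewrite <- S_INR. fold K. lra. }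
          rewrite HN, Rpow_mult_distr. apply Rmult_le_compat_r; [lra|].
          apply Rle_trans with (2 := HB).
          assert (INR (S m) / K <= eps / 2); [|lra].
          apply Rmult_le_reg_r with K; [easy|]. unfold Rdiv. rewrite Rmult_assoc, Rinv_l; lra. }
        assert (Hsum : (1 - eps / 2) * K ^ S m / INR (S m) <= sumR (S N) (fun j => INR j ^ m)).
        { apply Rmult_le_reg_r with (INR (S m)); [easy|]. unfold Rdiv.
          rewrite (Rmult_assoc _ (/ _)), Rinv_l; lra. }
        apply Rle_trans with (cst * ((1 - eps / 2) * K ^ S m / INR (S m))).
        2:{ now apply Rmult_le_compat_l. }
        unfold cst. rewrite fact_simpl, mult_INR.
        replace ((1 - eps / 2) * (s ^ S m / (K ^ S m * INR (fact m))) *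
                 ((1 - eps / 2) * K ^ S m / INR (S m)))
          with ((1 - eps / 2) * (1 - eps / 2) * (s ^ S m / (INR (S m) * INR (fact m)))).
        -- apply Rmult_le_compat_r; [|nra]. apply Rmult_le_pos; [easy|].
           left. apply Rinv_0_lt_compat. now apply Rmult_lt_0_compat.
        -- field. repeat split; lra.
      * rewrite sumL_seq, <- sumR_scal, (sumR_rev (S N)). apply sumR_ext. intros q Hq.
        unfold cst, lev. replace (S N - 1 - q)%nat with (N - q)%nat by lia.
        rewrite Nat.add_0_l. unfold Rdiv. rewrite !Rpow_mult_distr, pow_inv. simpl pow.
        field. repeat split; try lra. apply pow_nonzero. lra.
Qed.

(** * Linear maps *)

Definition row_map (m : nat) (r : nat -> R) (k : nat) (x : nat -> R) : nat -> R :=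
  upd x k (sumR m (fun j => r j * x j)).

(** Coordinate [k] is first scaled by [r k], then the other terms are added by shears, one column
    [p] at a time; only the scaling changes volume. *)
Lemma expands_row_map m r k :
  (k < m)%nat -> r k <> 0 -> expands m (row_map m r k) (/ Rabs (r k)).
Proof.
  intros Hk Hr. assert (Hd : 0 <= / Rabs (r k)).
  { left. now apply Rinv_0_lt_compat, Rabs_pos_lt. }
  assert (H : forall p, (p <= m)%nat -> expands m
    (fun x => upd x k (r k * x k + sumR p (fun j => if Nat.eqb j k then 0 else r j * x j)))
    (/ Rabs (r k))).
  { induction p as [|p IH]; intros Hp.
    - apply expands_ext with (fun x => upd x k (r k * x k)); [|now apply expands_scale].
      intros x i Hi. simpl. now rewrite Rplus_0_r.
    - destruct (Nat.eq_dec p k) as [->|Hpk].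
      + eapply expands_ext; [|apply IH; lia].
        intros x i Hi. simpl. rewrite Nat.eqb_refl. now rewrite Rplus_0_r.
      + rewrite <- (Rmult_1_l (/ Rabs (r k))).
        eapply expands_ext; [|apply (expands_comp m _ 1 _ _ (expands_shear m p k (r p) Hp Hk Hpk)
           (IH ltac:(lia)) ltac:(lra) Hd)].
        intros x i Hi. simpl. apply Nat.eqb_neq in Hpk as Hpk'. rewrite Hpk'.
        destruct (Nat.eq_dec i k) as [->|Hik].
        * rewrite !upd_eq, (upd_neq _ k _ p) by easy. ring.
        * now rewrite !upd_neq by easy. }
  eapply expands_ext; [|exact (H m (le_n m))].
  intros x i Hi. unfold row_map. destruct (Nat.eq_dec i k) as [->|Hik];
    [rewrite !upd_eq|now rewrite !upd_neq].
  rewrite (sumR_update m (fun j => r j * x j)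
    (fun j => if Nat.eqb j k then 0 else r j * x j) k Hk).
  - rewrite Nat.eqb_refl. ring.
  - intros j Hj Hn. now apply Nat.eqb_neq in Hn as ->.
Qed.

(** Row [p] reads only coordinates from [p] on, so replacing the rows in increasing order finds the
    original values still in place. *)
Lemma expands_upper m (T : nat -> nat -> R) :
  (forall i j, (j < i < m)%nat -> T i j = 0) -> (forall i, (i < m)%nat -> T i i <> 0) ->
  expands m (fun x i => sumR m (fun j => T i j * x j)) (/ Rabs (prodR m (fun i => T i i))).
Proof.
  intros HT Hd.
  assert (H : forall p, (p <= m)%nat -> expands m
    (fun x i => if Nat.ltb i p then sumR m (fun j => T i j * x j) else x i)
    (/ Rabs (prodR p (fun i => T i i)))).
  { induction p as [|p IH]; intros Hp.
    - simpl. rewrite Rabs_R1, Rinv_1. apply expands_id.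
    - simpl prodR. rewrite Rabs_mult, Rinv_mult, Rmult_comm.
      eapply expands_ext; [|apply (expands_comp m _ _ _ _
        (expands_row_map m (T p) p ltac:(lia) (Hd p ltac:(lia))) (IH ltac:(lia)))].
      + intros x i Hi. unfold row_map. destruct (Nat.eq_dec i p) as [->|Hip].
        * rewrite upd_eq. rewrite (proj2 (Nat.ltb_lt p (S p))) by lia.
          apply sumR_ext. intros j Hj. destruct (Nat.ltb_spec j p) as [Hjp|Hjp]; [|easy].
          rewrite HT by lia. ring.
        * rewrite upd_neq by easy.
          destruct (Nat.ltb_spec i p), (Nat.ltb_spec i (S p)); easy || lia.
      + left. apply Rinv_0_lt_compat, Rabs_pos_lt, Hd. lia.
      + rewrite <- Rabs_inv. apply Rabs_pos. }
  eapply expands_ext; [|exact (H m (le_n m))].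
  intros x i Hi. simpl. now rewrite (proj2 (Nat.ltb_lt i m)).
Qed.

(** Row [i] reads only coordinates up to [i], so the rows are replaced from the last one upwards. *)
Lemma expands_lower_unit m (T : nat -> nat -> R) :
  (forall i j, (i < j < m)%nat -> T i j = 0) -> (forall i, (i < m)%nat -> T i i = 1) ->
  expands m (fun x i => sumR m (fun j => T i j * x j)) 1.
Proof.
  intros HT Hd.
  assert (H : forall p, (p <= m)%nat -> expands m
    (fun x i => if Nat.leb (m - p) i then sumR m (fun j => T i j * x j) else x i) 1).
  { induction p as [|p IH]; intros Hp.
    - eapply expands_ext; [|apply expands_id]. intros x i Hi. simpl.
      destruct (Nat.leb_spec (m - 0) i); [lia|easy].
    - rewrite <- (Rmult_1_r 1).
      assert (Hk : (m - S p < m)%nat) by lia.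
      assert (Hrow := expands_row_map m (T (m - S p)%nat) (m - S p) Hk).
      rewrite Hd, Rabs_R1, Rinv_1 in Hrow by easy. specialize (Hrow ltac:(lra)).
      eapply expands_ext; [|apply (expands_comp m _ _ _ _ Hrow (IH ltac:(lia)) ltac:(lra) ltac:(lra))].
      intros x i Hi. unfold row_map. destruct (Nat.eq_dec i (m - S p)) as [->|Hip].
      + rewrite upd_eq. rewrite (proj2 (Nat.leb_le _ _)) by lia.
        apply sumR_ext. intros j Hj. destruct (Nat.leb_spec (m - p) j) as [Hjp|Hjp]; [|easy].
        rewrite HT by lia. ring.
      + rewrite upd_neq by easy.
        destruct (Nat.leb_spec (m - p) i), (Nat.leb_spec (m - S p) i); easy || lia. }
  eapply expands_ext; [|exact (H m (le_n m))].
  intros x i Hi. simpl. now rewrite (proj2 (Nat.leb_le (m - m) i)) by lia.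
Qed.

(** * Invertible matrices and the determinant of the chart *)

Module MatrixMaps.
From mathcomp Require Import all_boot all_fingroup all_algebra Rstruct.
Import GRing.Theory.
Local Set Implicit Arguments.
Local Unset Strict Implicit.
Local Open Scope ring_scope.

Lemma sumR_big m (f : nat -> R) : sumR m f = \sum_(i < m) f i.
Proof. by elim: m => [|m IH] /=; rewrite ?big_ord0 // big_ord_recr /= IH. Qed.

Lemma prodR_big m (f : nat -> R) : prodR m f = \prod_(i < m) f i.
Proof. by elim: m => [|m IH] /=; rewrite ?big_ord0 // big_ord_recr /= IH. Qed.

Definition mx_entry m (M : 'M[R]_m) (i j : nat) : R :=
  if insub i is Some i' then if insub j is Some j' then M i' j' else 0 else 0.

Lemma mx_entryE m (M : 'M[R]_m) (i j : 'I_m) : mx_entry M i j = M i j.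
Proof. by rewrite /mx_entry !valK. Qed.

Definition lin m (M : 'M[R]_m) (x : nat -> R) (i : nat) : R :=
  sumR m (fun j => Rmult (mx_entry M i j) (x j)).

Lemma linE m (M : 'M[R]_m) x (i : 'I_m) : lin M x i = \sum_(j < m) M i j * x j.
Proof. by rewrite /lin sumR_big; apply: eq_bigr => j _; rewrite mx_entryE. Qed.

Lemma lin_mul m (M N : 'M[R]_m) x i : (i < m)%coq_nat -> lin (M *m N) x i = lin M (lin N x) i.
Proof.
move=> /ltP lt_im; rewrite -[i]/(nat_of_ord (Ordinal lt_im)) !linE.
under eq_bigr => j _ do rewrite mxE mulr_suml.
rewrite exchange_big /=; apply: eq_bigr => k _.
by rewrite linE mulr_sumr; apply: eq_bigr => j _; rewrite mulrA.
Qed.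

Lemma lin1 m x i : (i < m)%coq_nat -> lin (1%:M : 'M[R]_m) x i = x i.
Proof.
move=> /ltP lt_im; rewrite -[i]/(nat_of_ord (Ordinal lt_im)) linE.
rewrite (bigD1 (Ordinal lt_im)) //= big1 ?addr0 ?mxE ?eqxx ?mul1r // => j /negPf ne.
by rewrite mxE eq_sym ne mul0r.
Qed.

Lemma lin_perm m (s : 'S_m) x (i : 'I_m) : lin (perm_mx s) x i = x (s i).
Proof.
rewrite linE (bigD1 (s i)) //= big1 ?addr0 ?mxE ?eqxx ?mul1r // => j /negPf ne.
by rewrite !mxE eq_sym ne mul0r.
Qed.

Definition perm_fun m (s : 'S_m) (x : nat -> R) (i : nat) : R :=
  if insub i is Some i' then x (s i' : 'I_m) else 0.

Lemma perm_funE m (s : 'S_m) x (i : 'I_m) : perm_fun s x i = x (s i).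
Proof. by rewrite /perm_fun valK. Qed.

Lemma expands_perm m (s : 'S_m) : expands m (lin (perm_mx s)) 1.
Proof.
apply: expands_by_box => [|b okb]; first exact: Rle_0_1.
exists (perm_fun s^-1%g b.1, perm_fun s^-1%g b.2); split; [|split; [|split]] => /=.
- move=> i /ltP lt_im /=; rewrite -[i]/(nat_of_ord (Ordinal lt_im)) !perm_funE.
  exact: okb (elimT ltP (ltn_ord _)).
- move=> x Hx i /ltP lt_im; rewrite -[i]/(nat_of_ord (Ordinal lt_im)) lin_perm.
  by have := Hx _ (elimT ltP (ltn_ord (s (Ordinal lt_im)))); rewrite /= !perm_funE permK.
- move=> x Hx i /ltP lt_im; rewrite -[i]/(nat_of_ord (Ordinal lt_im)) lin_perm.
  by have := Hx _ (elimT ltP (ltn_ord (s (Ordinal lt_im)))); rewrite /= !perm_funE permK.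
- rewrite Rmult_1_l /box_vol !prodR_big (reindex_inj (@perm_inj _ s)) /=.
  by apply: eq_bigr => i _; rewrite !perm_funE permK.
Qed.

Lemma expands_mul m (M N : 'M[R]_m) c d :
  Rle 0 c -> Rle 0 d -> expands m (lin M) c -> expands m (lin N) d ->
  expands m (lin (M *m N)) (Rmult c d).
Proof.
move=> c0 d0 HM HN; apply: expands_ext (expands_comp _ _ _ _ _ HM HN c0 d0) => x i Hi.
by rewrite lin_mul.
Qed.

Lemma Rabs_det_perm m (s : 'S_m) : Rabs (\det (perm_mx s : 'M[R]_m)) = 1.
Proof.
rewrite det_perm; case: (odd_perm s); rewrite ?expr0 ?expr1; last exact: Rabs_R1.
by rewrite [LHS]Rabs_Ropp; exact: Rabs_R1.
Qed.

(** In [M = P^-1 L U] only [U] changes volume, since [P] permutes coordinates and [L] has unit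
    diagonal; accordingly the determinants of [M] and [U] agree up to sign. *)
Lemma expands_lin m (M : 'M[R]_m.+1) :
  \det M != 0 -> expands m.+1 (lin M) (Rinv (Rabs (\det M))).
Proof.
move=> detM0.
have := cormen_lup_correct M; have := cormen_lup_perm M; have := cormen_lup_detL M.
have := @cormen_lup_lower _ _ M; have := @cormen_lup_upper _ _ M.
case: (cormen_lup M) => -[P L] U /= Uup Llow detL /is_perm_mxP [s ->] E.
have defM : M = perm_mx s^-1%g *m (L *m U).
  by rewrite -[L *m U]E mulmxA -perm_mxM mulVg perm_mx1 mul1mx.
have detU : \det U = \prod_(i < m.+1) U i i.
  (* [det_trig] concerns lower triangular matrices, hence the transpose. *)
  rewrite -det_tr det_trig; first by apply: eq_bigr => i _; rewrite mxE.
  by apply/is_trig_mxP => i j lt_ij; rewrite mxE Uup.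
have absdet : Rabs (\det M) = Rabs (\det U).
  by rewrite defM !det_mulmx detL mul1r Rabs_mult Rabs_det_perm Rmult_1_l.
have detU0 : \det U != 0.
  by apply: contraNneq detM0 => U0; rewrite defM !det_mulmx U0 !mulr0.
have HL : expands m.+1 (lin L) 1.
  apply: expands_lower_unit => [i j [/ltP lt_ij /ltP lt_j]|i /ltP lt_i].
    have lt_i := ltn_trans lt_ij lt_j.
    rewrite -[i]/(nat_of_ord (Ordinal lt_i)) -[j]/(nat_of_ord (Ordinal lt_j)) mx_entryE.
    by rewrite Llow ?(ltnW lt_ij) // -val_eqE /= ltn_eqF.
  by rewrite -[i]/(nat_of_ord (Ordinal lt_i)) mx_entryE Llow ?eqxx.
have HU : expands m.+1 (lin U) (Rinv (Rabs (\det U))).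
  have -> : \det U = prodR m.+1 (fun i => mx_entry U i i).
    by rewrite detU prodR_big; apply: eq_bigr => i _; rewrite mx_entryE.
  apply: expands_upper => [i j [/ltP lt_ji /ltP lt_i]|i /ltP lt_i].
    have lt_j := ltn_trans lt_ji lt_i.
    rewrite -[i]/(nat_of_ord (Ordinal lt_i)) -[j]/(nat_of_ord (Ordinal lt_j)) mx_entryE.
    exact: Uup.
  rewrite -[i]/(nat_of_ord (Ordinal lt_i)) mx_entryE; apply/eqP.
  by move: detU0; rewrite detU; move/prodf_neq0; apply.
have d0 : Rle 0 (Rinv (Rabs (\det U))).
  by rewrite -Rabs_inv; exact: Rabs_pos.
rewrite absdet defM -[Rinv _]Rmult_1_l -[Rmult 1 _]Rmult_1_l.
apply: expands_mul; [exact: Rle_0_1|by rewrite Rmult_1_l|exact: expands_perm|].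
by apply: expands_mul => //; exact: Rle_0_1.
Qed.

(* The rows [u 0, ..., u (m-1), a] form an orthogonal matrix, whose adjugate is up to sign
   its transpose, so the minor of its last entry is [a m] up to sign. *)
Lemma Rabs_det_chart m (a : nat -> R) (u : nat -> nat -> R) :
  on_sphere (S m) a -> orth_basis_compl (S m) a u ->
  Rabs (\det (\matrix_(i < m, j < m) u j i)) = Rabs (a m).
Proof.
move=> Ha [Hu Hua].
pose O : 'M[R]_m.+1 := \matrix_(i, j) if unlift ord_max i is Some k then u k j else a j.
have dotE (x y : nat -> R) : dot (S m) x y = \sum_(k < m.+1) x k * y k.
  by rewrite /dot sumR_big.
have ltm (k : 'I_m) : lt k (Nat.sub (S m) 1) by apply/ltP; rewrite [Nat.sub _ _]subn1.
have OOT : O *m O^T = 1%:M.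
  apply/matrixP => i j; rewrite !mxE.
  under eq_bigr => k _ do rewrite !mxE.
  case: (unliftP ord_max i) => [i'|] ->; case: (unliftP ord_max j) => [j'|] ->.
  - rewrite -dotE (Hu _ _ (ltm i') (ltm j')) (inj_eq lift_inj) -val_eqE /=.
    by case: (Nat.eqb_spec i' j') => [->|/eqP/negPf ->]; rewrite ?eqxx.
  - by rewrite -dotE (Hua _ (ltm i')) eq_sym (negPf (neq_lift _ _)).
  - rewrite (negPf (neq_lift _ _)); under eq_bigr => k _ do rewrite mulrC.
    by rewrite -dotE (Hua _ (ltm j')).
  - by rewrite -dotE [dot _ _ _]Ha eqxx.
have adjO : \adj O = \det O *: O^T.
  have OTO := mulmx1C OOT.
  by rewrite -[\adj O]mul1mx -OTO -mulmxA mul_mx_adj mul_mx_scalar.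
have detO2 : \det O * \det O = 1.
  by rewrite -{2}det_tr -det_mulmx OOT det1.
have absO : Rabs (\det O) = 1.
  have : Rmult (Rabs (\det O)) (Rabs (\det O)) = 1 by rewrite -Rabs_mult [Rmult _ _]detO2 Rabs_R1.
  move: (Rabs_pos (\det O)); move: (Rabs _) => z z0 zz.
  have z0' : Rle 0 z by [].
  have zz' : Rmult z z = IZR 1 by [].
  change (z = IZR 1); nra.
have := congr1 (fun X : 'M[R]_m.+1 => X ord_max ord_max) adjO.
rewrite !mxE unlift_none /cofactor => E.
have defM : row' ord_max (col' ord_max O) = (\matrix_(i < m, j < m) u j i)^T.
  by apply/matrixP => i j; rewrite !mxE liftK lift_max.
rewrite defM det_tr -signr_odd addnn odd_double expr0 mul1r in E.
by rewrite E Rabs_mult absO Rmult_1_l.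
Qed.

(** The first map is the linear part of the chart with the last coordinate dropped: projecting the
    hyperplane along the last axis multiplies area by [Rabs (a m)]. The right inverse [g] serves the
    upper bound through [content_le_expands]. *)
Lemma expands_chart m (a : nat -> R) (u : nat -> nat -> R) :
  (0 < m)%coq_nat -> on_sphere (S m) a -> orth_basis_compl (S m) a u -> a m <> IZR 0 ->
  expands m (fun y i => sumR m (fun j => Rmult (y j) (u j i))) (Rinv (Rabs (a m))) /\
  exists g, expands m g (Rabs (a m)) /\
    forall z i, (i < m)%coq_nat -> sumR m (fun j => Rmult (g z j) (u j i)) = z i.
Proof.
case: m => [|m] Hm Ha Hu am0; first by case: (Nat.lt_irrefl _ Hm).
pose M : 'M[R]_m.+1 := \matrix_(i, j) u j i.
have absM := Rabs_det_chart Ha Hu; rewrite -/M in absM.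
have detM0 : \det M != 0.
  apply/eqP => M0; apply: (Rabs_no_R0 _ am0).
  by rewrite -absM M0 Rabs_R0.
have linME y i : (i < m.+1)%coq_nat -> lin M y i = sumR m.+1 (fun j => Rmult (y j) (u j i)).
  move=> /ltP lt_im; rewrite -[i]/(nat_of_ord (Ordinal lt_im)) linE sumR_big.
  by apply: eq_bigr => j _; rewrite mxE mulrC.
have unitM : M \in unitmx by rewrite unitmxE unitfE.
split; first by rewrite -absM; apply: expands_ext (expands_lin detM0).
exists (lin (invmx M)); split.
  have detV : \det (invmx M) != 0 by rewrite det_inv invr_eq0.
  have := expands_lin detV; rewrite det_inv.
  by rewrite -[GRing.inv _]RinvE Rabs_inv Rinv_inv absM.
by move=> z i Hi; rewrite -linME // -lin_mul // mulmxV // lin1.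
Qed.

End MatrixMaps.

(** * Sections near a vertex of the cube *)

Lemma dot_sym n x y : dot n x y = dot n y x.
Proof. apply sumR_ext. intros; ring. Qed.

Lemma dot_comb n x y z c : dot n (fun i => x i - c * y i) z = dot n x z - c * dot n y z.
Proof.
  unfold dot. unfold Rminus. rewrite Ropp_mult_distr_l, <- sumR_scal, <- sumR_plus.
  apply sumR_ext. intros; ring.
Qed.

Definition unit_vec (k : nat) : nat -> R := fun i => if Nat.eqb i k then 1 else 0.

Lemma dot_unit_vec n k x : (k < n)%nat -> dot n (unit_vec k) x = x k.
Proof.
  intros Hk. unfold dot. rewrite (sumR_single n _ k Hk).
  - unfold unit_vec. rewrite Nat.eqb_refl. ring.
  - intros i _ Hn. unfold unit_vec. apply Nat.eqb_neq in Hn as ->. ring.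
Qed.

(* The images of the first [m] unit vectors under the Householder reflection that
   exchanges the lines spanned by [a] and the last unit vector. *)
Lemma orth_basis_compl_exists m a :
  on_sphere (S m) a -> exists u, orth_basis_compl (S m) a u.
Proof.
  (* The sign of [a m] avoids cancellation in [w], which is [a] plus [s] times the last unit vector:
     the product of [w] with [a] is [1 + Rabs (a m)], never zero. *)
  intros Ha. set (s := if Rle_dec 0 (a m) then 1 else -1).
  assert (Hs : s * s = 1) by (unfold s; destruct (Rle_dec 0 (a m)); lra).
  assert (Hsa : s * a m = Rabs (a m)).
  { unfold s. destruct (Rle_dec 0 (a m)); [rewrite Rabs_pos_eq|rewrite Rabs_left]; lra. }
  set (w := fun i => a i - (- s) * unit_vec m i).
  set (c := 1 + Rabs (a m)). assert (Hc : 0 < c) by (assert (H := Rabs_pos (a m)); unfold c; lra).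
  assert (Hwa : dot (S m) w a = c).
  { unfold w. rewrite dot_comb, Ha, dot_unit_vec by lia. unfold c. lra. }
  assert (Hww : dot (S m) w w = 2 * c).
  { unfold w at 1. rewrite dot_comb, dot_unit_vec, dot_sym, Hwa by lia.
    unfold w, unit_vec. rewrite Nat.eqb_refl. unfold c. lra. }
  assert (Hwj : forall j, (j < m)%nat -> w j = a j).
  { intros j Hj. unfold w, unit_vec. destruct (Nat.eqb_spec j m); [lia|ring]. }
  exists (fun j i => unit_vec j i - (w j / c) * w i). split.
  - intros i j Hi Hj. rewrite dot_comb, dot_unit_vec by lia.
    rewrite (dot_sym _ w), dot_comb, dot_unit_vec, Hww by lia.
    unfold unit_vec. destruct (Nat.eqb_spec i j); field; lra.
  - intros j Hj. rewrite dot_comb, dot_unit_vec, Hwa, Hwj by lia. field. lra.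
Qed.

Lemma sumR_minus_term_nonneg n f k :
  (k < n)%nat -> (forall i, (i < n)%nat -> 0 <= f i) -> 0 <= sumR n f - f k.
Proof.
  intros Hk H. rewrite (sumR_update n f (upd f k 0) k Hk).
  - rewrite upd_eq. assert (0 <= sumR n (upd f k 0)); [|lra].
    apply sumR_nonneg. intros i Hi. unfold upd. destruct (Nat.eqb i k); [lra|auto].
  - intros i Hi Hn. now rewrite upd_neq.
Qed.

(** The squared deviations of the [m] coordinates other than [k] from their mean [c] have a
    nonnegative sum. *)
Lemma Cauchy_Schwarz_others m f k :
  (0 < m)%nat -> (k < S m)%nat ->
  (sumR (S m) f - f k) ^ 2 <= INR m * (sumR (S m) (fun i => f i ^ 2) - f k ^ 2).
Proof.
  intros Hm Hk. assert (HM : 0 < INR m) by (now apply lt_0_INR).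
  set (T := sumR (S m) f - f k). set (c := T / INR m).
  assert (H := sumR_minus_term_nonneg (S m) (fun i => (f i - c) ^ 2) k Hk
    (fun i _ => pow2_ge_0 _)). cbv beta in H.
  replace (sumR (S m) (fun i => (f i - c) ^ 2))
    with (sumR (S m) (fun i => f i ^ 2) + (-2 * c) * sumR (S m) f + INR (S m) * c ^ 2) in H.
  2:{ rewrite <- sumR_const, <- sumR_scal, <- !sumR_plus. apply sumR_ext. intros; ring. }
  rewrite S_INR in H. fold T.
  assert (Hc : INR m * c = T) by (unfold c; field; lra).
  replace (sumR (S m) f) with (T + f k) in H by (unfold T; ring).
  set (Q := sumR (S m) (fun i => f i ^ 2)) in *.
  apply Rmult_le_compat_l with (r := INR m) in H; [|lra].
  clearbody Q T c. subst T. nra.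
Qed.

Definition abs_sum (n : nat) (a : nat -> R) : R := sumR n (fun i => Rabs (a i)).

Lemma on_sphere_pow2 n a : on_sphere n a -> sumR n (fun i => Rabs (a i) ^ 2) = 1.
Proof.
  intros Ha. rewrite <- Ha. apply sumR_ext. intros i _. rewrite pow2_abs. ring.
Qed.

(* Hence a hyperplane at distance [t > sqrt m / 2] cuts off at most one vertex. *)
Lemma gap_lt_coord m a t k :
  (0 < m)%nat -> on_sphere (S m) a -> sqrt (INR m) / 2 < t -> (k < S m)%nat ->
  2 * (abs_sum (S m) a / 2 - t) < Rabs (a k).
Proof.
  intros Hm Ha Ht Hk.
  assert (H := Cauchy_Schwarz_others m (fun i => Rabs (a i)) k Hm Hk). cbv beta in H.
  rewrite (on_sphere_pow2 _ _ Ha) in H. fold (abs_sum (S m) a) in H.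
  assert (HM : 0 <= INR m) by apply pos_INR.
  assert (abs_sum (S m) a - Rabs (a k) <= sqrt (INR m)); [|lra].
  assert (Hs := sqrt_sqrt (INR m) HM). assert (Hs0 := sqrt_pos (INR m)).
  apply Rnot_lt_le. intros Hlt. assert (0 <= Rabs (a k) ^ 2) by apply pow2_ge_0. nra.
Qed.

Lemma hyper_param_sum m a t u y k :
  hyper_param (S m) a t u y k = t * a k + sumR m (fun i => y i * u i k).
Proof. unfold hyper_param. simpl. now rewrite Nat.sub_0_r. Qed.

Lemma dot_hyper_param m a t u y z :
  dot (S m) z (hyper_param (S m) a t u y) =
  t * dot (S m) z a + sumR m (fun i => y i * dot (S m) z (u i)).
Proof.
  unfold dot. rewrite <- sumR_scal.
  rewrite (sumR_ext m (fun i => y i * sumR (S m) (fun i0 => z i0 * u i i0))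
    (fun i => sumR (S m) (fun i0 => y i * (z i0 * u i i0)))) by (intros; now rewrite sumR_scal).
  rewrite sumR_swap, <- sumR_plus. apply sumR_ext. intros k Hk.
  rewrite hyper_param_sum, Rmult_plus_distr_l, <- sumR_scal. f_equal; [ring|].
  apply sumR_ext. intros; ring.
Qed.

Lemma dot_normal_hyper_param m a t u y :
  on_sphere (S m) a -> orth_basis_compl (S m) a u ->
  dot (S m) a (hyper_param (S m) a t u y) = t.
Proof.
  intros Ha [_ Hu]. rewrite dot_hyper_param, Ha, (sumR_ext m _ (fun _ => 0)).
  - rewrite sumR_const. ring.
  - intros i Hi. rewrite dot_sym, Hu by lia. ring.
Qed.

Lemma dot_basis_hyper_param m a t u y k :
  orth_basis_compl (S m) a u -> (k < m)%nat ->
  dot (S m) (u k) (hyper_param (S m) a t u y) = y k.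
Proof.
  intros [Hu Hua] Hk. rewrite dot_hyper_param, Hua by lia. rewrite (sumR_single m _ k Hk).
  - rewrite Hu, Nat.eqb_refl by lia. ring.
  - intros i Hi Hn. rewrite Hu by lia. destruct (Nat.eqb_spec k i); [lia|ring].
Qed.

Lemma Rabs_prodR n f : Rabs (prodR n f) = prodR n (fun i => Rabs (f i)).
Proof. induction n as [|n IH]; simpl; [apply Rabs_R1|]. now rewrite Rabs_mult, IH. Qed.

Lemma Rinv_prodR n f : / prodR n (fun i => / f i) = prodR n f.
Proof. induction n as [|n IH]; simpl; [apply Rinv_1|]. now rewrite Rinv_mult, Rinv_inv, IH. Qed.

Lemma expands_diag m r :
  (forall i, (i < m)%nat -> r i <> 0) ->
  expands m (fun x i => r i * x i) (/ Rabs (prodR m r)).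
Proof.
  intros Hr. assert (H := expands_upper m (fun i j => if Nat.eqb i j then r i else 0)).
  assert (E : prodR m (fun i => if Nat.eqb i i then r i else 0) = prodR m r).
  { apply prodR_ext. intros. now rewrite Nat.eqb_refl. }
  cbv beta in H. rewrite E in H. eapply expands_ext; [|apply H].
  - intros x i Hi. simpl. rewrite (sumR_single m _ i Hi).
    + now rewrite Nat.eqb_refl.
    + intros j Hj Hn. destruct (Nat.eqb_spec i j); [lia|ring].
  - intros i j Hij. destruct (Nat.eqb_spec i j); [lia|easy].
  - intros i Hi. rewrite Nat.eqb_refl. now apply Hr.
Qed.

Lemma abs_mul_bound a x : -(1/2) <= x <= 1/2 -> 0 <= Rabs a / 2 - a * x.
Proof. intros Hx. unfold Rabs. destruct (Rcase_abs a); nra. Qed.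

(** Each summand is a simplex coordinate [z_i]: the slack, scaled by [Rabs (a i)], of the face of
    the cube towards which [a] points. *)
Lemma gap_sum m a t u y :
  on_sphere (S m) a -> orth_basis_compl (S m) a u ->
  sumR (S m) (fun i => Rabs (a i) / 2 - a i * hyper_param (S m) a t u y i) =
  abs_sum (S m) a / 2 - t.
Proof.
  intros Ha Hu. assert (E := dot_normal_hyper_param m a t u y Ha Hu).
  transitivity (abs_sum (S m) a / 2 - dot (S m) a (hyper_param (S m) a t u y)); [|now rewrite E].
  unfold abs_sum, dot, Rdiv, Rminus.
  rewrite Rmult_comm, <- sumR_scal.
  replace (- sumR (S m) (fun i => a i * hyper_param (S m) a t u y i)) with
    (-1 * sumR (S m) (fun i => a i * hyper_param (S m) a t u y i)) by ring.
  rewrite <- sumR_scal, <- sumR_plus. apply sumR_ext. intros; ring.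
Qed.

Definition corner_volume (m : nat) (a : nat -> R) (t : R) : R :=
  (abs_sum (S m) a / 2 - t) ^ m / (INR (fact m) * prodR (S m) (fun i => Rabs (a i))).

Lemma A_corner m a t :
  (0 < m)%nat -> on_sphere (S m) a -> sqrt (INR m) / 2 < t ->
  0 < abs_sum (S m) a / 2 - t -> A (S m) a t = corner_volume m a t.
Proof.
  intros Hm Ha Ht Hd. unfold A, corner_volume.
  set (u := basis_compl (S m) a).
  assert (Hu : orth_basis_compl (S m) a u).
  { unfold u, basis_compl. apply epsilon_spec. now apply orth_basis_compl_exists. }
  replace (S m - 1)%nat with m by lia.
  set (S0 := fun y => in_cube (S m) (hyper_param (S m) a t u y)).
  set (d := abs_sum (S m) a / 2 - t) in *.
  assert (Hgap : forall k, (k < S m)%nat -> 2 * d < Rabs (a k)).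
  { intros k Hk. now apply gap_lt_coord. }
  assert (Ha0 : forall k, (k < S m)%nat -> a k <> 0).
  { intros k Hk E. specialize (Hgap k Hk). rewrite E, Rabs_R0 in Hgap. lra. }
  destruct (MatrixMaps.expands_chart Hm Ha Hu (Ha0 m ltac:(lia)))
    as (Hchart & g & Hg & Hgi).
  set (r := fun i => - a i / d).
  assert (Hr : forall i, (i < m)%nat -> r i <> 0).
  { intros i Hi. unfold r, Rdiv. apply Rmult_integral_contrapositive_currified.
    - specialize (Ha0 i ltac:(lia)). lra.
    - apply Rinv_neq_0_compat. lra. }
  set (c := fun i => Rabs (a i) / 2 / d - a i * (t * a i) / d).
  (* [G] sends a chart point to its slacks divided by [d], for [i < m], so that the section becomes
     the preimage of the unit simplex. *)
  set (G := fun y i => r i * sumR m (fun j => y j * u j i) + c i).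
  assert (HGE : forall y i, G y i = (Rabs (a i) / 2 - a i * hyper_param (S m) a t u y i) / d).
  { intros y i. unfold G, r, c. rewrite hyper_param_sum. field. lra. }
  assert (Habs : forall i, (i < S m)%nat -> 0 < Rabs (a i)).
  { intros i Hi. apply Rabs_pos_lt. auto. }
  assert (Hprod : 0 < prodR (S m) (fun i => Rabs (a i))) by (now apply prodR_pos).
  assert (Hdm : 0 < d ^ m) by (now apply pow_lt).
  assert (Hrm : Rabs (prodR m r) * Rabs (a m) = prodR (S m) (fun i => Rabs (a i)) / d ^ m).
  { simpl. assert (E : Rabs (prodR m r) = prodR m (fun i => Rabs (a i)) / d ^ m).
    { rewrite Rabs_prodR, (prodR_ext m _ (fun i => Rabs (a i) * / d)).
      - rewrite prodR_mult, prodR_const, pow_inv. easy.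
      - intros i _. unfold r, Rdiv. rewrite Rabs_mult, Rabs_Ropp, (Rabs_pos_eq (/ d)); [easy|].
        left. now apply Rinv_0_lt_compat. }
    rewrite E. field. lra. }
  set (D := prodR (S m) (fun i => Rabs (a i)) / d ^ m) in *.
  assert (HD : 0 < D) by (now apply Rdiv_lt_0_compat).
  assert (Hr0 : 0 < Rabs (prodR m r)).
  { apply Rabs_pos_lt. intros E. rewrite E, Rabs_R0, Rmult_0_l in Hrm. lra. }
  assert (HG : expands m G (/ D)).
  { rewrite <- Hrm, Rinv_mult, <- (Rmult_1_l (/ Rabs (prodR m r) * _)).
    apply (expands_comp m (fun x i => x i + c i) 1
      (fun y i => r i * sumR m (fun j => y j * u j i))).
    - apply expands_translate.
    - apply (expands_comp m (fun x i => r i * x i) _ (fun y i => sumR m (fun j => y j * u j i))).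
      + now apply expands_diag.
      + exact Hchart.
      + left. now apply Rinv_0_lt_compat.
      + left. apply Rinv_0_lt_compat. apply Habs. lia.
    - lra.
    - apply Rmult_le_pos; left; apply Rinv_0_lt_compat; [easy|apply Habs; lia]. }
  set (G' := fun z => g (fun i => / r i * (z i + - c i))).
  assert (HG' : expands m G' D).
  { rewrite <- Hrm, Rmult_comm, <- (Rmult_1_r (Rabs (prodR m r))).
    apply (expands_comp m g _ (fun z i => / r i * (z i + - c i)) (Rabs (prodR m r) * 1)).
    - exact Hg.
    - apply (expands_comp m (fun x i => / r i * x i) _ (fun z i => z i + - c i) 1).
      + replace (Rabs (prodR m r)) with (/ Rabs (prodR m (fun i => / r i))).
        * apply expands_diag. intros. apply Rinv_neq_0_compat. auto.
        * rewrite <- Rabs_inv. f_equal. apply Rinv_prodR.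
      + apply expands_translate.
      + lra.
      + lra.
    - apply Rabs_pos.
    - lra. }
  assert (HGG : forall z i, (i < m)%nat -> G (G' z) i = z i).
  { intros z i Hi. unfold G, G'. rewrite Hgi by easy. field. now apply Hr. }
  (* The condition [sumR m (G y) <= 1] says that the last slack is nonnegative. The opposite faces
     add no condition: each slack is at most [d], and [2 * d < Rabs (a i)]. *)
  assert (HS : forall y, S0 y <-> simplex m 1 (G y)).
  { intros y. set (x := hyper_param (S m) a t u y).
    assert (Hsum := gap_sum m a t u y Ha Hu). fold d x in Hsum. simpl in Hsum.
    assert (HsG : sumR m (G y) = sumR m (fun i => Rabs (a i) / 2 - a i * x i) / d).
    { unfold Rdiv at 1. rewrite Rmult_comm, <- sumR_scal. apply sumR_ext.
      intros. rewrite HGE. fold x. field. lra. }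
    split.
    - intros Hy. split.
      + intros i Hi. rewrite HGE. apply Rmult_le_pos; [|left; now apply Rinv_0_lt_compat].
        apply abs_mul_bound, Hy. lia.
      + rewrite HsG. apply Rmult_le_reg_r with d; [easy|]. unfold Rdiv at 1.
        rewrite Rmult_assoc, Rinv_l by lra.
        assert (H := abs_mul_bound (a m) (x m) (Hy m ltac:(lia))). lra.
    - intros [Hp Hs]. rewrite HsG in Hs.
      assert (Hs' : sumR m (fun i => Rabs (a i) / 2 - a i * x i) <= d).
      { apply Rmult_le_compat_r with (r := d) in Hs; [|lra]. unfold Rdiv in Hs at 1.
        rewrite Rmult_assoc, Rinv_l in Hs; lra. }
      assert (Hp' : forall i, (i < S m)%nat -> 0 <= Rabs (a i) / 2 - a i * x i).
      { intros i Hi. destruct (Nat.eq_dec i m) as [->|Hn]; [lra|].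
        specialize (Hp i ltac:(lia)). rewrite HGE in Hp. fold x in Hp.
        apply Rmult_le_compat_r with (r := d) in Hp; [|lra]. unfold Rdiv in Hp at 1.
        rewrite Rmult_assoc, Rinv_l in Hp; lra. }
      assert (Hq : forall i, (i < S m)%nat -> Rabs (a i) / 2 - a i * x i <= d).
      { intros i Hi. assert (H := sumR_minus_term_nonneg (S m) _ i Hi Hp'). cbv beta in H. simpl in H. lra. }
      intros i Hi. specialize (Hp' i Hi). specialize (Hq i Hi). specialize (Hgap i Hi).
      fold x. clear -Hp' Hq Hgap Hd. unfold Rabs in *. destruct (Rcase_abs (a i)); nra. }
  replace (d ^ m / (INR (fact m) * prodR (S m) (fun i => Rabs (a i))))
    with (/ D * (1 ^ m / INR (fact m))).
  2:{ unfold D. rewrite pow1. field. repeat split; try lra. apply INR_fact_neq_0. }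
  assert (Hf : 0 <= 1 ^ m / INR (fact m)).
  { rewrite pow1. apply Rmult_le_pos; [lra|]. left. apply Rinv_0_lt_compat, INR_fact_lt_0. }
  apply inner_content_eq.
  - rewrite Rmult_comm. apply (content_le_expands m G' D (simplex m 1) S0); [easy|easy| |].
    + intros z Hz. apply HS in Hz. destruct Hz as [H1 H2]. split.
      * intros i Hi. rewrite <- (HGG z i Hi). auto.
      * rewrite <- (sumR_ext m (G (G' z))); auto.
    + apply content_le_simplex. lra.
  - apply (content_ge_expands m G (/ D) (simplex m 1) S0); [easy| | | |].
    + left. now apply Rinv_0_lt_compat.
    + exact Hf.
    + intros y Hy. now apply HS.
    + apply content_ge_simplex. lra.
  - apply Rmult_le_pos; [left; now apply Rinv_0_lt_compat|easy].
Qed.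

(** At a point of the section all slacks are nonnegative with sum [d <= 0], so they vanish and the
    point is a fixed vertex; every box in the section is then flat in direction 0. *)
Lemma A_empty m a t :
  (0 < m)%nat -> on_sphere (S m) a -> sqrt (INR m) / 2 < t ->
  abs_sum (S m) a / 2 - t <= 0 -> A (S m) a t = 0.
Proof.
  intros Hm Ha Ht Hd. unfold A.
  set (u := basis_compl (S m) a).
  assert (Hu : orth_basis_compl (S m) a u).
  { unfold u, basis_compl. apply epsilon_spec. now apply orth_basis_compl_exists. }
  replace (S m - 1)%nat with m by lia.
  set (S0 := fun y => in_cube (S m) (hyper_param (S m) a t u y)).
  set (d := abs_sum (S m) a / 2 - t) in *.
  assert (Hgap : forall k, (k < S m)%nat -> 2 * d < Rabs (a k)).
  { intros k Hk. now apply gap_lt_coord. }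
  assert (Hy0 : forall y, S0 y -> forall i, (i < S m)%nat ->
     d = 0 /\ a i * hyper_param (S m) a t u y i = Rabs (a i) / 2).
  { intros y Hy i Hi. assert (Hsum := gap_sum m a t u y Ha Hu). fold d in Hsum.
    assert (Hp : forall i, (i < S m)%nat ->
      0 <= Rabs (a i) / 2 - a i * hyper_param (S m) a t u y i).
    { intros j Hj. apply abs_mul_bound. now apply Hy. }
    assert (H := sumR_minus_term_nonneg (S m) _ i Hi Hp). rewrite Hsum in H.
    specialize (Hp i Hi). cbv beta in H. lra. }
  assert (Hyy : forall y z, S0 y -> S0 z -> y 0%nat = z 0%nat).
  { intros y z Hy Hz.
    rewrite <- (dot_basis_hyper_param m a t u y 0 Hu Hm),
            <- (dot_basis_hyper_param m a t u z 0 Hu Hm).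
    apply sumR_ext. intros i Hi. f_equal.
    destruct (Hy0 y Hy i Hi) as [E1 E2]. destruct (Hy0 z Hz i Hi) as [_ E3].
    (* Since [d = 0], the gap bound says that [a i] is nonzero. *)
    specialize (Hgap i Hi). apply Rmult_eq_reg_l with (a i); [lra|].
    intros E. rewrite E, Rabs_R0 in Hgap. lra. }
  apply inner_content_eq; [| |lra].
  - intros bs [Hbs _]. induction bs as [|b bs IH]; simpl; [lra|].
    destruct (Hbs b (or_introl eq_refl)) as (Hok & Hin & _).
    assert (Hb : box_vol m b = 0).
    { apply (prodR_zero m _ 0 Hm). rewrite (Hyy (snd b) (fst b)); [ring| |];
        apply Hin; intros i Hi; specialize (Hok i Hi); lra. }
    rewrite Hb. assert (total_vol m bs <= 0); [|lra].
    apply IH. intros c Hc. apply Hbs. now right.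
  - intros eps _. exists []. split; [apply box_family_nil|]. simpl. lra.
Qed.

(** * The diagonal direction is extremal *)

(** For the difference [f] of the logarithm and the exponent, [f'] changes sign only at [5/13] and
    [1]: from [1/4] on, [f] rises, falls to [f 1 = 0] and rises again, so only [f (1/4) >= 0] needs
    numerics. *)
Lemma exp_quadratic_le b : 1 / 4 <= b -> exp (b - 1 - 13 / 10 * (b - 1) ^ 2) <= b.
Proof.
  intros Hb. rewrite <- (exp_ln b) at 3 by lra.
  enough (Hln : b - 1 - 13 / 10 * (b - 1) ^ 2 <= ln b).
  { destruct Hln as [Hln|Hln]; [left; now apply exp_increasing|right; now rewrite Hln]. }
  set (f := fun x => ln x - (x - 1) + 13 / 10 * (x - 1) ^ 2).
  set (f' := fun x => (x - 1) * (13 / 5 - / x)).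
  assert (Hder : forall x, 0 < x -> derivable_pt_lim f x (f' x)).
  { intros x Hx. unfold f, f'.
    replace ((x - 1) * (13 / 5 - / x)) with (/ x - (1 - 0) + 13 / 10 * (INR 2 * (x - 1) ^ 1 * (1 - 0)))
      by (simpl; field; lra).
    apply derivable_pt_lim_plus; [apply derivable_pt_lim_minus|].
    - now apply derivable_pt_lim_ln.
    - apply derivable_pt_lim_minus; [apply derivable_pt_lim_id|apply derivable_pt_lim_const].
    - apply derivable_pt_lim_scal.
      apply (derivable_pt_lim_comp (fun x => x - 1) (fun y => y ^ 2)).
      + apply derivable_pt_lim_minus; [apply derivable_pt_lim_id|apply derivable_pt_lim_const].
      + apply derivable_pt_lim_pow. }
  assert (Hmvt : forall u v, 0 < u -> u < v -> exists c, f v - f u = f' c * (v - u) /\ u < c < v).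
  { intros u v Hu Huv. apply MVT_cor2; [easy|]. intros c Hc. apply Hder. lra. }
  assert (f1 : f 1 = 0) by (unfold f; rewrite ln_1; ring).
  assert (f4 : 0 <= f (1 / 4)).
  (* [1.48125] is [3/4 + 13/10 * (3/4)^2]. Split into 12 equal parts, it is small enough for
     [exp x >= 1 + x] to give [exp 1.48125 > 4]. *)
  { unfold f. assert (ln 4 < 1.48125).
    { rewrite <- (ln_exp 1.48125). apply ln_increasing; [lra|].
      set (e := exp 0.1234375).
      replace (exp 1.48125) with ((e * e * e * e) * (e * e * e * e) * (e * e * e * e)).
      2:{ unfold e. rewrite <- !exp_plus. f_equal. lra. }
      assert (He : 1.1234 <= e) by (unfold e; assert (H := exp_ineq1_le 0.1234375); lra).
      assert (He2 : 1.262 <= e * e) by nra.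
      assert (He4 : 1.592 <= e * e * e * e).
      { replace (e * e * e * e) with ((e * e) * (e * e)) by ring. nra. }
      set (k := e * e * e * e) in *. assert (2.53 <= k * k) by nra. nra. }
    replace (1 / 4) with (/ 4) by field. rewrite ln_Rinv by lra. lra. }
  assert (Hf : 0 <= f b).
  { destruct (Rtotal_order b 1) as [H|[->|H]].
    - destruct (Rle_or_lt (5 / 13) b) as [Hb'|Hb'].
      + destruct (Hmvt b 1) as (c & Hc & Hc'); [lra|lra|]. unfold f' in Hc.
        assert (/ c <= / (5 / 13)) by (apply Rinv_le_contravar; lra).
        replace (/ (5 / 13)) with (13 / 5) in H0 by field.
        assert (0 <= (1 - c) * (13 / 5 - / c)) by (apply Rmult_le_pos; lra). nra.
      + destruct Hb as [Hb| <-]; [|easy].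
        destruct (Hmvt (1 / 4) b) as (c & Hc & Hc'); [lra|lra|]. unfold f' in Hc.
        assert (/ (5 / 13) <= / c) by (apply Rinv_le_contravar; lra).
        replace (/ (5 / 13)) with (13 / 5) in H0 by field.
        assert (0 <= (1 - c) * (/ c - 13 / 5)) by (apply Rmult_le_pos; lra). nra.
    - lra.
    - destruct (Hmvt 1 b) as (c & Hc & Hc'); [lra|lra|]. unfold f' in Hc.
      assert (/ c <= / 1) by (apply Rinv_le_contravar; lra). rewrite Rinv_1 in H0.
      assert (0 <= (c - 1) * (13 / 5 - / c)) by (apply Rmult_le_pos; lra). nra. }
  unfold f in Hf. lra.
Qed.

Lemma exp_sumR_le_prodR n f b :
  (forall i, (i < n)%nat -> exp (f i) <= b i) -> exp (sumR n f) <= prodR n b.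
Proof.
  induction n as [|n IH]; intros H; simpl; [rewrite exp_0; lra|].
  rewrite exp_plus. apply Rmult_le_compat; try (left; apply exp_pos).
  - apply IH. intros; apply H; lia.
  - apply H; lia.
Qed.

(* [E] measures the deviation of [b] from the constant vector [1], and [E0] is the largest
   deviation for which no coordinate can vanish.  At most one coordinate is below [1/4];
   all others are controlled by [exp_quadratic_le], whose exponents sum to [-18/5 * E],
   and the exceptional one by [E0 - E <= b k]. *)
Lemma prodR_lower_bound m b E E0 :
  (2 <= m)%nat -> (forall i, (i < S m)%nat -> 0 <= b i) ->
  sumR (S m) b = INR (S m) - E -> sumR (S m) (fun i => b i ^ 2) = INR (S m) ->
  E0 = INR (S m) - sqrt (INR (S m) * INR m) -> E < E0 ->
  (1 - E / E0) ^ m <= prodR (S m) b.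
Proof.
  intros Hm Hb Hs1 Hs2 HE0 HE.
  set (q := sqrt (INR (S m) * INR m)) in *.
  set (N := INR (S m)) in *.
  assert (HM : 2 <= INR m) by (apply (le_INR 2); lia).
  assert (HN : INR m = N - 1) by (unfold N; rewrite S_INR; ring).
  assert (Hq0 : 0 <= q) by apply sqrt_pos.
  assert (Hq : q * q = N * (N - 1)).
  { unfold q. rewrite sqrt_sqrt; [now rewrite HN|]. rewrite HN in *. nra. }
  rewrite HN in HM.
  assert (HE1 : 0 < E0 < 1) by (split; nra).
  assert (HE2 : N * (2 * E0 - 1) = E0 * E0) by nra.
  assert (HE3 : 1 / 2 <= E0) by nra.
  assert (HE4 : E0 <= 0.551) by nra.
  set (h := fun i => (b i - 1) ^ 2).
  assert (Hh : sumR (S m) h = 2 * E).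
  { transitivity (sumR (S m) (fun i => b i ^ 2) + (-2) * sumR (S m) b + INR (S m) * 1).
    - rewrite <- sumR_const, <- sumR_scal, <- !sumR_plus. apply sumR_ext.
      intros; unfold h; ring.
    - rewrite Hs1, Hs2. fold N. ring. }
  assert (Hh0 : forall i, (i < S m)%nat -> 0 <= h i) by (intros; apply pow2_ge_0).
  assert (HEpos : 0 <= E) by (assert (H := sumR_nonneg _ _ Hh0); lra).
  set (w := 1 - E / E0).
  assert (HwE : w * E0 = E0 - E) by (unfold w; field; lra).
  assert (Hw : 0 < w <= 1) by (split; nra).
  set (f := fun i => b i - 1 - 13 / 10 * (b i - 1) ^ 2).
  assert (Hf : sumR (S m) f = - (18 / 5 * E)).
  { transitivity (sumR (S m) b + (- 13 / 10) * sumR (S m) h + INR (S m) * (-1)).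
    - rewrite <- sumR_const, <- sumR_scal, <- !sumR_plus. apply sumR_ext.
      intros; unfold f, h; lra.
    - rewrite Hs1, Hh. fold N. lra. }
  apply Rle_trans with (w ^ 2).
  { replace m with (2 + (m - 2))%nat by lia. rewrite pow_add.
    assert (w ^ (m - 2) <= 1) by (rewrite <- (pow1 (m - 2)); apply pow_incr; lra).
    assert (0 <= w ^ 2) by apply pow2_ge_0. nra. }
  destruct (classic (exists k, (k < S m)%nat /\ b k < 1 / 4)) as [(k & Hk & Hbk)|Hall].
  - assert (HCS := Cauchy_Schwarz_others m b k ltac:(lia) Hk).
    rewrite Hs1, Hs2 in HCS. fold N in HCS. rewrite HN in HCS.
    (* Cauchy-Schwarz bounds the sum of the other coordinates by [q], so
       [b k >= N - E - q = E0 - E]. *)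
    assert (Hwk : w * E0 <= b k).
    { rewrite HwE. assert (0 <= b k ^ 2) by apply pow2_ge_0.
      assert (N - E - b k <= q); [|lra]. apply Rnot_lt_le. intros Hlt. nra. }
    assert (Hhk : 9 / 16 <= h k) by (unfold h; specialize (Hb k Hk); nra).
    (* Two coordinates below [1/4] would contribute at least [9/8] to a sum [2 * E < 1.102]. *)
    assert (Hoth : forall i, (i < S m)%nat -> i <> k -> 1 / 4 <= b i).
    { intros i Hi Hn. assert (Hik := sumR_minus_term_nonneg (S m) (upd h k 0) i Hi).
      rewrite upd_neq in Hik by easy.
      assert (Hsu := sumR_update (S m) h (upd h k 0) k Hk).
      rewrite upd_eq, Hh in Hsu. rewrite Hsu in * by (intros; now rewrite upd_neq).
      assert (Hi2 : h i <= 2 * E - h k).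
      { assert (H : 0 <= sumR (S m) (upd h k 0) - h i).
        - apply Hik. intros j Hj. unfold upd. destruct (Nat.eqb j k); [lra|auto].
        - specialize (Hsu ltac:(intros; now rewrite upd_neq)). lra. }
      unfold h in Hi2 at 1. nra. }
    assert (HP := prodR_update (S m) b (upd b k 1) k Hk).
    rewrite upd_eq, Rmult_1_r in HP. rewrite HP by (intros; now rewrite upd_neq).
    assert (Hexp : exp (sumR (S m) (upd f k 0)) <= prodR (S m) (upd b k 1)).
    { apply exp_sumR_le_prodR. intros i Hi. destruct (Nat.eq_dec i k) as [->|Hn].
      - rewrite !upd_eq, exp_0. lra.
      - rewrite !upd_neq by easy. apply exp_quadratic_le. auto. }
    assert (Hsf := sumR_update (S m) f (upd f k 0) k Hk).
    rewrite upd_eq, Hf in Hsf. specialize (Hsf ltac:(intros; now rewrite upd_neq)).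
    (* [f k] is below the value [-1.48125] of the exponent at [1/4]; leaving it out of the sum gains
       that much. *)
    assert (Hfk : f k <= -(1.481)).
    { unfold f. specialize (Hb k Hk). nra. }
    assert (Hlin : 1.481 - 18 / 5 * E <= sumR (S m) (upd f k 0)) by lra.
    assert (HX := exp_ineq1_le (sumR (S m) (upd f k 0))).
    (* The factor [b k >= w * E0] supplies one [w]; the other coordinates must supply [w / E0], for
       which [exp x >= 1 + x] is sharp enough. *)
    assert (HwX : w <= E0 * prodR (S m) (upd b k 1)).
    { apply Rle_trans with (E0 * (1 + (1.481 - 18 / 5 * E))).
      - replace E with (E0 - w * E0) by lra. nra.
      - apply Rmult_le_compat_l; lra. }
    replace (w ^ 2) with (w * w) by ring.
    apply Rle_trans with (w * (E0 * prodR (S m) (upd b k 1))).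
    + apply Rmult_le_compat_l; lra.
    + rewrite <- Rmult_assoc, (Rmult_comm _ (b k)).
      apply Rmult_le_compat_r; [|easy].
      apply Rle_trans with (2 := Hexp). left. apply exp_pos.
  - apply Rle_trans with (exp (sumR (S m) f)).
    + rewrite Hf. replace (- (18 / 5 * E)) with (- (9 / 5 * E) + - (9 / 5 * E)) by lra.
      rewrite exp_plus. assert (HX := exp_ineq1_le (- (9 / 5 * E))).
      (* This is [E0 <= 5/9]. *)
      assert (w <= 1 - 9 / 5 * E) by nra.
      replace (w ^ 2) with (w * w) by ring. apply Rmult_le_compat; lra.
    + apply exp_sumR_le_prodR. intros i Hi. apply exp_quadratic_le.
      apply Rnot_lt_le. intros Hlt. apply Hall. eauto.
Qed.

Lemma abs_sum_le_sqrt m a : on_sphere (S m) a -> abs_sum (S m) a <= sqrt (INR (S m)).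
Proof.
  intros Ha. set (N := INR (S m)).
  assert (HN : 0 < N) by (apply lt_0_INR; lia).
  assert (Hs := sqrt_lt_R0 N HN). assert (Hss := sqrt_sqrt N ltac:(lra)).
  assert (H : 0 <= sumR (S m) (fun i => (sqrt N * Rabs (a i) - 1) ^ 2)).
  { apply sumR_nonneg. intros; apply pow2_ge_0. }
  replace (sumR (S m) (fun i => (sqrt N * Rabs (a i) - 1) ^ 2)) with
    (N * sumR (S m) (fun i => Rabs (a i) ^ 2) + (-2 * sqrt N) * abs_sum (S m) a + INR (S m) * 1) in H.
  - rewrite (on_sphere_pow2 _ _ Ha) in H. fold N in H. nra.
  - unfold abs_sum. rewrite <- sumR_const, <- !sumR_scal, <- !sumR_plus. apply sumR_ext.
    intros i _. rewrite <- Hss at 1. ring.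
Qed.

(** In [prodR_lower_bound] the base [1 - E / E0] becomes [(s - rm) / (rn - rm)], the ratio of the
    two gaps at [t = rm / 2]; [Hd'] shows that the ratio is no larger at the given [t]. *)
Lemma corner_volume_le m a t :
  (2 <= m)%nat -> on_sphere (S m) a -> sqrt (INR m) / 2 < t -> t <= sqrt (INR (S m)) / 2 ->
  0 < abs_sum (S m) a / 2 - t ->
  corner_volume m a t <=
  sqrt (INR (S m)) ^ S m / INR (fact m) * (sqrt (INR (S m)) / 2 - t) ^ m.
Proof.
  intros Hm Ha Ht Ht' Hd.
  assert (Hgap : forall k, (k < S m)%nat -> 0 < Rabs (a k)).
  { intros k Hk. assert (H := gap_lt_coord m a t k ltac:(lia) Ha Ht Hk). lra. }
  assert (HP : 0 < prodR (S m) (fun i => Rabs (a i))) by (now apply prodR_pos).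
  assert (Hle := abs_sum_le_sqrt m a Ha).
  set (s := abs_sum (S m) a) in *.
  assert (HM : 0 < INR m) by (apply lt_0_INR; lia).
  assert (HN0 : 0 < INR (S m)) by (apply lt_0_INR; lia).
  assert (Hrn := sqrt_sqrt (INR (S m)) ltac:(lra)). assert (Hrm := sqrt_sqrt (INR m) ltac:(lra)).
  assert (Hrm0 := sqrt_lt_R0 _ HM). assert (Hrn0 := sqrt_lt_R0 _ HN0).
  assert (Hlt : sqrt (INR m) < sqrt (INR (S m))).
  { apply sqrt_lt_1; [lra|lra|]. rewrite S_INR. lra. }
  assert (Hlow := prodR_lower_bound m (fun i => sqrt (INR (S m)) * Rabs (a i))
    (INR (S m) - sqrt (INR (S m)) * s) (INR (S m) - sqrt (INR (S m) * INR m)) Hm).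
  rewrite sqrt_mult in Hlow by lra.
  rewrite prodR_mult, prodR_const in Hlow.
  set (rn := sqrt (INR (S m))) in *. set (rm := sqrt (INR m)) in *.
  assert (Hlow' : ((s - rm) / (rn - rm)) ^ m <= rn ^ S m * prodR (S m) (fun i => Rabs (a i))).
  { replace ((s - rm) / (rn - rm)) with (1 - (INR (S m) - rn * s) / (INR (S m) - rn * rm)).
    - apply Hlow.
      + intros i Hi. apply Rmult_le_pos; [lra|]. left. auto.
      + rewrite sumR_scal. fold (abs_sum (S m) a). fold s. ring.
      + transitivity (INR (S m) * sumR (S m) (fun i => Rabs (a i) ^ 2)).
        * rewrite <- sumR_scal. apply sumR_ext. intros i _. rewrite <- Hrn. ring.
        * rewrite (on_sphere_pow2 _ _ Ha). ring.
      + easy.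
      + assert (rn * rm < rn * s); [|lra]. apply Rmult_lt_compat_l; lra.
    - rewrite <- Hrn. field. split; nra. }
  assert (Hd' : s / 2 - t <= (s - rm) / (rn - rm) * (rn / 2 - t)).
  { apply Rmult_le_reg_r with (rn - rm); [lra|].
    replace ((s - rm) / (rn - rm) * (rn / 2 - t) * (rn - rm)) with ((s - rm) * (rn / 2 - t))
      by (field; lra).
    assert (0 <= (rn - s) * (t - rm / 2)) by (apply Rmult_le_pos; lra). nra. }
  assert (Hpow : (s / 2 - t) ^ m <= ((s - rm) / (rn - rm) * (rn / 2 - t)) ^ m).
  { apply pow_incr. lra. }
  rewrite Rpow_mult_distr in Hpow.
  assert (Hf := INR_fact_lt_0 m).
  unfold corner_volume. fold s. set (P := prodR (S m) (fun i => Rabs (a i))) in *.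
  apply Rmult_le_reg_r with (INR (fact m) * P); [now apply Rmult_lt_0_compat|].
  unfold Rdiv at 1. rewrite Rmult_assoc, Rinv_l, Rmult_1_r by nra.
  replace (rn ^ S m / INR (fact m) * (rn / 2 - t) ^ m * (INR (fact m) * P))
    with (rn ^ S m * P * (rn / 2 - t) ^ m) by (field; lra).
  apply Rle_trans with (1 := Hpow). apply Rmult_le_compat_r; [|easy].
  apply pow_le. lra.
Qed.

Lemma abs_adiag m i : Rabs (adiag (S m) i) = / sqrt (INR (S m)).
Proof.
  assert (H := sqrt_lt_R0 (INR (S m)) (lt_0_INR (S m) ltac:(lia))).
  unfold adiag, Rdiv. rewrite Rmult_1_l. apply Rabs_pos_eq. left. now apply Rinv_0_lt_compat.
Qed.

Lemma on_sphere_adiag m : on_sphere (S m) (adiag (S m)).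
Proof.
  assert (HN0 := lt_0_INR (S m) ltac:(lia)). assert (H := sqrt_lt_R0 _ HN0).
  assert (Hss := sqrt_sqrt (INR (S m)) ltac:(lra)).
  unfold on_sphere, dot, adiag. rewrite sumR_const.
  set (r := sqrt (INR (S m))) in *. rewrite <- Hss. field. lra.
Qed.

Lemma A_adiag m t :
  (0 < m)%nat -> sqrt (INR m) / 2 < t -> t <= sqrt (INR (S m)) / 2 ->
  A (S m) (adiag (S m)) t =
  sqrt (INR (S m)) ^ S m / INR (fact m) * (sqrt (INR (S m)) / 2 - t) ^ m.
Proof.
  intros Hm Ht Ht'.
  assert (HN0 := lt_0_INR (S m) ltac:(lia)). assert (H := sqrt_lt_R0 _ HN0).
  assert (Hss := sqrt_sqrt (INR (S m)) ltac:(lra)).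
  assert (Hs : abs_sum (S m) (adiag (S m)) = sqrt (INR (S m))).
  { unfold abs_sum. rewrite (sumR_ext _ _ (fun _ => / sqrt (INR (S m)))), sumR_const.
    - rewrite <- Hss at 1. field. lra.
    - intros; apply abs_adiag. }
  (* At the right end of the range the section is a vertex and both sides vanish. *)
  destruct Ht' as [Ht'|Ht'].
  - rewrite A_corner; [|easy|apply on_sphere_adiag|easy|rewrite Hs; lra].
    unfold corner_volume. rewrite Hs.
    rewrite (prodR_ext _ _ (fun _ => / sqrt (INR (S m)))), prodR_const, pow_inv
      by (intros; apply abs_adiag).
    field. split; [apply INR_fact_neq_0|]. apply pow_nonzero. lra.
  - rewrite A_empty; [|easy|apply on_sphere_adiag|easy|rewrite Hs; lra].
    rewrite <- Ht', Rminus_diag, pow_i by easy. ring.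
Qed.

(** * The square *)

Lemma abs_sum_2_sqr a : on_sphere 2 a -> abs_sum 2 a ^ 2 = 1 + 2 * (Rabs (a 0%nat) * Rabs (a 1%nat)).
Proof.
  intros Ha. apply on_sphere_pow2 in Ha. simpl in Ha. unfold abs_sum. simpl. lra.
Qed.

Lemma A_corner_2 a t :
  on_sphere 2 a -> 1 / 2 < t -> 2 * t < abs_sum 2 a ->
  A 2 a t = (abs_sum 2 a - 2 * t) / (abs_sum 2 a ^ 2 - 1).
Proof.
  intros Ha Ht Hs.
  assert (Hm : sqrt (INR 1) / 2 < t) by (simpl; rewrite sqrt_1; lra).
  assert (Hd : 0 < abs_sum 2 a / 2 - t) by lra.
  rewrite (A_corner 1 a t); [|lia|easy|easy|easy].
  assert (H0 := gap_lt_coord 1 a t 0 ltac:(lia) Ha Hm ltac:(lia)).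
  assert (H1 := gap_lt_coord 1 a t 1 ltac:(lia) Ha Hm ltac:(lia)).
  unfold corner_volume. rewrite (abs_sum_2_sqr a Ha). simpl prodR. simpl fact. simpl INR.
  set (s := abs_sum 2 a) in *. field. split; [nra|lra].
Qed.

Lemma Rdiv_1_sqrt_2 : 1 / sqrt 2 = sqrt 2 / 2.
Proof.
  assert (H2 := sqrt_sqrt 2 ltac:(lra)). assert (H0 := sqrt_lt_R0 2 ltac:(lra)).
  apply Rmult_eq_reg_r with (2 * sqrt 2); [|lra]. transitivity 2; [field; lra|].
  transitivity (sqrt 2 * sqrt 2); [lra|field].
Qed.

Lemma A_adiag_2 t :
  1 / 2 < t -> t <= 1 / sqrt 2 -> A 2 (adiag 2) t = sqrt 2 - 2 * t.
Proof.
  intros Ht Ht'. assert (H2 := sqrt_sqrt 2 ltac:(lra)). assert (H0 := sqrt_lt_R0 2 ltac:(lra)).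
  assert (E := Rdiv_1_sqrt_2).
  rewrite (A_adiag 1 t); [|lia|simpl; rewrite sqrt_1; lra|].
  - simpl fact. replace (INR 2) with 2 by (simpl; ring). simpl INR.
    simpl pow. rewrite !Rmult_1_r, H2. field.
  - replace (INR 2) with 2 by (simpl; ring). lra.
Qed.

(** The right side minus the left is affine in [t] with slope [2 * (2 - s^2) >= 0], and at
    [t = 3/8 * sqrt 2] it equals [sqrt 2 / 4 * (s - sqrt 2)^2]. *)
Lemma planar_inequality s t :
  3 / 8 * sqrt 2 < t -> 1 < s -> s <= sqrt 2 -> s - 2 * t <= (sqrt 2 - 2 * t) * (s ^ 2 - 1).
Proof.
  intros Ht Hs Hs'. assert (H2 := sqrt_sqrt 2 ltac:(lra)). set (r := sqrt 2) in *.
  assert (0 <= (2 - s ^ 2) * (2 * (t - 3 / 8 * r))) by (apply Rmult_le_pos; nra).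
  assert (0 <= r / 4 * (s - r) ^ 2) by (apply Rmult_le_pos; [lra|apply pow2_ge_0]).
  nra.
Qed.

(* At [t = 3/8 * sqrt 2] both sides of [planar_inequality] are tangent at [s = sqrt 2];
   below that value, directions slightly off the diagonal do better. *)
Lemma planar_counterexample t :
  1 / 2 < t -> t < 3 / 8 * sqrt 2 ->
  exists s, 2 * t < s < sqrt 2 /\ (sqrt 2 - 2 * t) * (s ^ 2 - 1) < s - 2 * t.
Proof.
  intros Ht Ht'. assert (H2 := sqrt_sqrt 2 ltac:(lra)). assert (H0 := sqrt_lt_R0 2 ltac:(lra)).
  set (r := sqrt 2) in *.
  assert (Hk : 0 < 3 - 4 * r * t) by nra.
  (* For [s = r - e] the gain is [e * (3 - 4 * r * t - e * (r - 2 * t))]. The first bound on [e]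
     keeps [s] above [2 * t]; the second makes the gain positive because [r - 2 * t < 1]. *)
  set (e := Rmin (r - 2 * t) (3 - 4 * r * t) / 2).
  assert (He : 0 < e).
  { unfold e. assert (0 < Rmin (r - 2 * t) (3 - 4 * r * t)) by (apply Rmin_glb_lt; lra). lra. }
  assert (He1 : e < r - 2 * t).
  { unfold e in *. assert (H := Rmin_l (r - 2 * t) (3 - 4 * r * t)). lra. }
  assert (He2 : e < 3 - 4 * r * t).
  { unfold e in *. assert (H := Rmin_r (r - 2 * t) (3 - 4 * r * t)). lra. }
  exists (r - e). split; [lra|].
  assert (Hr : r - 2 * t < 1) by nra.
  assert (0 < e * ((3 - 4 * r * t) - e * (r - 2 * t))) by (apply Rmult_lt_0_compat; nra).
  replace ((r - 2 * t) * ((r - e) ^ 2 - 1)) with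
    ((r - 2 * t) * (r * r - 1) - 2 * e * (r * r) + 4 * e * r * t + e * e * (r - 2 * t)) by ring.
  rewrite H2. lra.
Qed.

Lemma planar_direction s :
  1 < s -> s < sqrt 2 -> exists a, on_sphere 2 a /\ abs_sum 2 a = s.
Proof.
  intros Hs Hs'. assert (H2 := sqrt_sqrt 2 ltac:(lra)).
  (* [r] is the difference of the two coordinates: with sum [s], their squares add up to
     [(s^2 + r^2) / 2]. *)
  set (r := sqrt (2 - s ^ 2)).
  assert (Hr : r * r = 2 - s ^ 2) by (apply sqrt_sqrt; nra).
  assert (Hr0 : 0 <= r) by apply sqrt_pos.
  assert (Hrs : r <= s) by nra.
  exists (fun i => match i with O => (s + r) / 2 | _ => (s - r) / 2 end). split.
  - unfold on_sphere, dot. simpl. nra.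
  - unfold abs_sum. simpl. rewrite !Rabs_pos_eq; lra.
Qed.

Theorem theorem4 :
  (forall (n : nat) (t : R), (3 <= n)%nat ->
     sqrt (INR n - 1) / 2 < t -> t <= sqrt (INR n) / 2 ->
     forall a : nat -> R, on_sphere n a ->
       A n a t <= A n (adiag n) t /\
       A n (adiag n) t =
         sqrt (INR n) ^ n / INR (fact (n - 1)) * (sqrt (INR n) / 2 - t) ^ (n - 1))
  /\
  (forall t : R, 3 / 8 * sqrt 2 < t -> t <= 1 / sqrt 2 ->
     forall a : nat -> R, on_sphere 2 a -> A 2 a t <= A 2 (adiag 2) t)
  /\
  (forall t : R, 1 / 2 < t -> t < 3 / 8 * sqrt 2 ->
     exists a : nat -> R, on_sphere 2 a /\ A 2 (adiag 2) t < A 2 a t).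
Proof.
  assert (H2 := sqrt_sqrt 2 ltac:(lra)). assert (H0 := sqrt_lt_R0 2 ltac:(lra)).
  assert (E2 := Rdiv_1_sqrt_2).
  split; [|split].
  - intros n t Hn Ht Ht' a Ha. destruct n as [|m]; [lia|].
    replace (INR (S m) - 1) with (INR m) in Ht by (rewrite S_INR; ring).
    replace (S m - 1)%nat with m by lia.
    assert (E := A_adiag m t ltac:(lia) Ht Ht'). split; [|exact E].
    rewrite E. destruct (Rle_or_lt (abs_sum (S m) a / 2 - t) 0) as [Hd|Hd].
    + rewrite A_empty; [|lia|easy|easy|easy].
      apply Rmult_le_pos; [|apply pow_le; lra].
      apply Rmult_le_pos; [apply pow_le, sqrt_pos|].
      left. apply Rinv_0_lt_compat, INR_fact_lt_0.
    + rewrite A_corner; [|lia|easy|easy|easy]. apply corner_volume_le; auto. lia.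
  (* [3/8 * sqrt 2] exceeds [1/2], so at most one vertex is cut off here too. *)
  - intros t Ht Ht' a Ha. assert (Ht2 : 1 / 2 < t) by nra.
    rewrite A_adiag_2 by easy.
    destruct (Rle_or_lt (abs_sum 2 a) (2 * t)) as [Hd|Hd].
    + rewrite (A_empty 1 a t); [lra|lia|easy|simpl; rewrite sqrt_1; lra|lra].
    + rewrite A_corner_2 by easy.
      assert (Hle := abs_sum_le_sqrt 1 a Ha). replace (INR 2) with 2 in Hle by (simpl; ring).
      assert (H := planar_inequality (abs_sum 2 a) t Ht ltac:(lra) Hle).
      assert (Hp : 0 < abs_sum 2 a ^ 2 - 1) by nra.
      apply Rmult_le_reg_r with (abs_sum 2 a ^ 2 - 1); [easy|].
      unfold Rdiv. rewrite Rmult_assoc, Rinv_l; lra.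
  - intros t Ht Ht'.
    destruct (planar_counterexample t Ht Ht') as (s & Hs & Hlt).
    destruct (planar_direction s ltac:(lra) ltac:(lra)) as (a & Ha & Hsa).
    exists a. split; [easy|].
    rewrite A_adiag_2, A_corner_2, Hsa; [|easy|easy|lra|easy|lra].
    assert (Hp : 0 < s ^ 2 - 1) by nra.
    apply Rmult_lt_reg_r with (s ^ 2 - 1); [easy|].
    unfold Rdiv. rewrite Rmult_assoc, Rinv_l; lra.
Qed.
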